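(* Let $k \ge 2$ and $N$ be integers with $4 \mid N$, let $\chi$ be a Dirichlet character modulo $N$ with $\chi^2 = 1$, and let $f = \sum_{n=1}^\infty a(n) q^n \in S_{k+1/2}(N,\chi)$ be a non-zero cuspidal Hecke eigenform (for the operators $T_{p^2}$ for primes $p \nmid N$) of weight $k + \frac12$ with real coefficients $a(n)$. Let $t \ge 1$ be a squarefree integer with $a(t) > 0$, and let $F_t = \sum_{n=1}^\infty A_t(n)q^n$ be the Shimura lift of $f$ with respect to $t$. Assume that $F_t$ does not have complex multiplication. Assume moreover that there are $C > 0$ and $\alpha > 0$ such that for all subintervals $[a,b] \subseteq [-1,1]$ and all real $x \ge 2$ one has $$\left| \frac{\#\{p \le x \text{ prime} : \frac{A_t(p)}{2a(t)p^{k-1/2}} \in [a,b]\}}{\pi(x)} - \mu([a,b]) \right| \le \frac{C}{x^\alpha}.$$ Then the sets $$\{n \in \mathbb{N} : a(tn^2) > 0\} \quad\text{and}\quad \{n \in \mathbb{N} : a(tn^2) < 0\}$$ have equal positive Dedekind-Dirichlet densities, that is, both densities are precisely half of the Dedekind-Dirichlet density of the set $\{n \in \mathbb{N} : a(tn^2) \ne 0\}$.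
   Context: Here $q = e^{2\pi i z}$, $\mathbb{N}$ is the set of positive integers, and $S_{k+1/2}(N,\chi)$ is the space of cusp forms of weight $k+\frac12$, level $N$ and character $\chi$ in the sense of Shimura. For a prime $p \nmid N$ the Hecke operator $T_{p^2}$ sends $\sum a(n)q^n$ to the form whose $n$-th coefficient is $a(p^2 n) + \chi(p)\left(\frac{(-1)^k n}{p}\right)p^{k-1}a(n) + \chi(p^2)p^{2k-1}a(n/p^2)$, with $a(n/p^2)=0$ if $p^2 \nmid n$. Shimura lift: for squarefree $t$ with $a(t) \neq 0$, the Shimura lift of $f$ is $F_t = \sum_{n=1}^\infty A_t(n) q^n \in S_{2k}(N/2,\chi^2)$, an eigenform for the Hecke operators $T_p$ for primes $p \nmid N$, of integral weight $2k$, whose coefficients are given by $$A_t(n) = \sum_{d \mid n} \chi_{t,N}(d)\, d^{k-1}\, a\!\left(\frac{tn^2}{d^2}\right), \qquad \chi_{t,N}(d) := \chi(d)\left(\frac{(-1)^k N^2 t}{d}\right).$$ $\mu$ is the Sato-Tate measure, the probability measure $\frac{2}{\pi}\sqrt{1-u^2}\,du$ on $[-1,1]$, and $\pi(x) = \#\{p \le x : p \text{ prime}\}$. Dedekind-Dirichlet density: a subset $A \subseteq \mathbb{N}$ has Dedekind-Dirichlet density $\delta(A)$ if $\lim_{z \to 1^+} (z-1)\sum_{n \in A} \frac{1}{n^z}$ exists (limit over real $z$ tending to $1$ from the right) and equals $\delta(A)$. *)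

(* Defs.v *)
From mathcomp Require Import all_boot all_order all_algebra.
From mathcomp Require Import complex.
From mathcomp Require Import all_classical all_reals all_analysis.

Set Implicit Arguments.
Unset Strict Implicit.
Unset Printing Implicit Defensive.

Import Order.TTheory GRing.Theory Num.Theory numFieldNormedType.Exports.
Local Open Scope classical_set_scope.
Local Open Scope ring_scope.
Local Open Scope complex_scope.

Definition squarefree (t : nat) : Prop :=
  forall d : nat, (d ^ 2 %| t)%N -> d = 1%N.

Definition legendre (a : int) (p : nat) : int :=
  if (p%:Z %| a)%Z then 0
  else if [exists x : 'I_p, (x%:Z ^+ 2 == a %[mod p%:Z])%Z] then 1
  else -1.

(* Meant for n >= 1. *)
Definition kronecker (a : int) (n : nat) : int :=
  \prod_(p <- primes n)
    (if p == 2%N then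
       (if (2 %| a)%Z then 0
        else if ((a %% 8)%Z == 1) || ((a %% 8)%Z == 7) then 1 else -1)
     else legendre a p) ^+ logn p n.

Definition dirichlet_character (R : realType) (N : nat) (chi : int -> R[i]) : Prop :=
  [/\ chi 1 = 1,
      forall m n : int, chi (m * n) = chi m * chi n,
      forall m : int, chi (m + N%:Z) = chi m
    & forall m : int, (chi m != 0) = coprimez m N%:Z].

Definition principal (R : realType) (N : nat) (chi : int -> R[i]) : Prop :=
  forall m : int, coprimez m N%:Z -> chi m = 1.

(* #{p <= x : p prime, P p}; in particular pi(x) = prime_count predT x. *)
Definition prime_count (R : realType) (P : pred nat) (x : R) : nat :=
  (\sum_(p < (Num.truncn x).+1 | prime p && P p) 1)%N.

(* Dedekind-Dirichlet density of the set of positive elements of A. *)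
Definition dd_density (R : realType) (A : set nat) (delta : R) : Prop :=
  (fun z : R =>
     (z - 1) * limn (fun m : nat => \sum_(1 <= n < m | n \in A) (n%:R `^ z)^-1))
    @ 1^'+ --> delta.

Definition sato_tate (R : realType) (A : set R) : R :=
  \int[lebesgue_measure]_(u in A `&` `[-1, 1]) (2 / pi * Num.sqrt (1 - u ^+ 2)).

(* Functions on the upper half-plane are total functions R[i] -> R[i] of which
   only the values at points with positive imaginary part matter. *)

Definition cexp (R : realType) (z : R[i]) : R[i] :=
  (expR (complex.Re z) * cos (complex.Im z)) +i* (expR (complex.Re z) * sin (complex.Im z)).

(* e^(2 pi i z) *)
Definition e2pi (R : realType) (z : R[i]) : R[i] :=
  cexp ((2 * pi)%:C * 'i * z).

(* R[i]^o is R[i] with its norm topology and its structure of normed module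
   over itself, so that derivability is complex derivability. *)
Definition holomorphic_upper (R : realType) (f : R[i] -> R[i]) : Prop :=
  forall z : R[i], 0 < complex.Im z -> derivable (f : R[i]^o -> R[i]^o) z 1.

Definition q_expansion (R : realType) (f : R[i] -> R[i]) (a : nat -> R[i]) : Prop :=
  forall z : R[i], 0 < complex.Im z ->
    (fun m : nat => \sum_(1 <= n < m) a n * e2pi z ^+ n)
      @ \oo --> (f z : R[i]^o).

Definition denom (R : realType) (A : 'M[int]_2) (z : R[i]) : R[i] :=
  (A 1 0)%:~R * z + (A 1 1)%:~R.

Definition moebius (R : realType) (A : 'M[int]_2) (z : R[i]) : R[i] :=
  ((A 0 0)%:~R * z + (A 0 1)%:~R) / denom A z.

(* theta(z) = sum over all integers n of e^(2 pi i n^2 z) *)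
Definition theta (R : realType) (z : R[i]) : R[i] :=
  1 + 2 * limn (fun m : nat =>
                  (\sum_(1 <= n < m) e2pi (n%:R ^+ 2 * z)) : R[i]^o).

(* Shimura's automorphy factor j(A, z) for A in Gamma_0(4). *)

Definition theta_factor (R : realType) (A : 'M[int]_2) (z : R[i]) : R[i] :=
  theta (moebius A z) / theta z.

Definition Gamma0 (N : nat) (A : 'M[int]_2) : Prop :=
  \det A = 1 /\ (N%:Z %| A 1%R 0%R)%Z.

(* (A, phi) is an element of Shimura's covering group lying over A in SL_2(Z). *)
Definition metaplectic (R : realType) (A : 'M[int]_2) (phi : R[i] -> R[i]) : Prop :=
  [/\ \det A = 1,
      holomorphic_upper phi
    & exists tau : R[i], `|tau| = 1 /\
        forall z : R[i], 0 < complex.Im z -> phi z ^+ 2 = tau * denom A z].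

(* f | [(A, phi)] in weight kappa / 2 *)
Definition slash (R : realType) (kappa : nat) (f : R[i] -> R[i])
    (A : 'M[int]_2) (phi : R[i] -> R[i]) (z : R[i]) : R[i] :=
  f (moebius A z) * phi z ^- kappa.

(* g(z) = sum_(n >= 0) c_n e^(2 pi i (n + r) z / h) for some h > 0 and
   0 <= r < 1, without constant term. *)
Definition vanishes_at_infinity (R : realType) (g : R[i] -> R[i]) : Prop :=
  exists (h : nat) (r : R) (c : nat -> R[i]),
    [/\ (0 < h)%N, 0 <= r < 1, (r = 0 -> c 0%N = 0)
      & forall z : R[i], 0 < complex.Im z ->
          (fun m : nat => \sum_(n < m) c n * e2pi (((n%:R + r) / h%:R)%:C * z))
            @ \oo --> (g z : R[i]^o)].

(* f belongs to S_(k + 1/2)(N, chi); meant for 4 dividing N. *)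
Definition half_integral_cusp_form (R : realType) (k N : nat)
    (chi : int -> R[i]) (f : R[i] -> R[i]) : Prop :=
  [/\ holomorphic_upper f,
      forall A : 'M[int]_2, Gamma0 N A -> forall z : R[i], 0 < complex.Im z ->
        slash k.*2.+1 f A (theta_factor A) z = chi (A 1 1) * f z
    & forall (A : 'M[int]_2) (phi : R[i] -> R[i]), metaplectic A phi ->
        vanishes_at_infinity (slash k.*2.+1 f A phi)].

(* The n-th coefficient of T_(p^2) applied to the form with coefficients a. *)
Definition hecke_coef (R : realType) (k : nat) (chi : int -> R[i])
    (a : nat -> R[i]) (p n : nat) : R[i] :=
  a (p ^ 2 * n)%N
  + chi p%:Z * (kronecker ((-1) ^+ k * n%:Z) p)%:~R * p%:R ^+ k.-1 * a n
  + chi (p%:Z ^+ 2) * p%:R ^+ k.*2.-1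
    * (if (p ^ 2 %| n)%N then a (n %/ p ^ 2)%N else 0).

Definition hecke_eigenform (R : realType) (k N : nat) (chi : int -> R[i])
    (a : nat -> R[i]) : Prop :=
  forall p : nat, prime p -> ~~ (p %| N)%N ->
    exists lambda : R[i], forall n : nat, (0 < n)%N ->
      hecke_coef k chi a p n = lambda * a n.

Definition chi_tN (R : realType) (k N t : nat) (chi : int -> R[i]) (d : nat) : R[i] :=
  chi d%:Z * (kronecker ((-1) ^+ k * N%:Z ^+ 2 * t%:Z) d)%:~R.

(* A_t(n), the n-th coefficient of the Shimura lift of the form with
   coefficients a. *)
Definition shimura_coef (R : realType) (k N t : nat) (chi : int -> R[i])
    (a : nat -> R[i]) (n : nat) : R[i] :=
  \sum_(d <- divisors n)
    chi_tN k N t chi d * d%:R ^+ k.-1 * a (t * n ^ 2 %/ d ^ 2)%N.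

(* Complex multiplication in the sense of Ribet: phi(p) A(p) = A(p) for some
   non-trivial Dirichlet character phi and all primes p in a set of density 1. *)
Definition has_CM (R : realType) (A : nat -> R[i]) : Prop :=
  exists (D : nat) (phi : int -> R[i]),
    [/\ (0 < D)%N, dirichlet_character D phi, ~ principal D phi
      & (fun x : R => (prime_count (fun p => phi p%:Z * A p == A p) x)%:R
                      / (prime_count predT x)%:R : R)
          @ +oo --> (1 : R)].

(* Main.v *)
Require Import Defs.
From mathcomp Require Import all_boot all_order all_algebra.
From mathcomp Require Import complex.
From mathcomp Require Import all_classical all_reals all_analysis.
From mathcomp Require Import ring lra zify.
Set Implicit Arguments.
Unset Strict Implicit.
Unset Printing Implicit Defensive.
Import Order.TTheory GRing.Theory Num.Theory numFieldNormedType.Exports.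
Local Open Scope classical_set_scope.
Local Open Scope ring_scope.
Local Open Scope complex_scope.

(** Write s(n) for the sign of a(t n^2). The Hecke relations at a prime p not
dividing N express a(t p^(2j) m^2), for m prime to p, as a(t m^2) times a
factor that depends on p and j only, so s is multiplicative away from N:
s(p^j m) = s(p^j) s(m) (eigenform_square_multiplicative).

At a prime, A_t(p) differs from a(t p^2) by at most p^(k-1) a(t), so the
normalised value A_t(p) / (2 a(t) p^(k-1/2)) has the sign of a(t p^2) unless it
lies within 1 / (2 sqrt p) of 0. The Sato-Tate measure of [-1, 0] is 1/2 and its
density is bounded; the assumed rate of convergence therefore gives, with some
beta > 0, both sum_(p <= x) s(p) <= C x^(1-beta) and
#{p <= x : s(p) = 0} <= C x^(1-beta) (prime_sign_sums_le). By Abel summation,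
sum_p s(p) p^(-z) is bounded above uniformly for 1 <= z <= 2, and the sum of
1/p over the primes with s(p) = 0 converges.

Signs cancel. The Euler factor of s at p has absolute value at most
exp(s(p) p^(-z) + O(p^(-2))). Removing primes not dividing N one at a time
shows that sum_n s(n) n^(-z), restricted to n prime to N, is bounded as
z -> 1+, and each prime dividing N costs at most a factor 2
(dseries_factoring_bounded). After multiplication by z - 1 the limit is 0.

The set {s <> 0} has a positive density. Let P >= N. Outside the multiples of
e^2 with e >= P and of the primes p >= P with s(p) = 0, whether s(n) vanishes depends
only on gcd(n, (P!)^(2P)) (nonvanishing_gcd). The exceptional n have upper
density at most the tail of a convergent series, so the indicator function of
{s <> 0} is a limit of periodic functions and (z - 1) sum_n |s(n)| n^(-z) is
Cauchy as z -> 1+. Among the n prime to P! the exceptional ones form at most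
half when P is large, which bounds the density below by a positive constant
(nonvanishing_density).

The indicator functions of {s > 0} and {s < 0} are (|s| + s) / 2 and
(|s| - s) / 2, so each has half of the density of {s <> 0}. *)

(** * Dirichlet series with bounded coefficients *)

(** The mean value inequalities for x^(-b) on [x, y], obtained from
1 - 1/u <= ln u <= u - 1 with u = y / x and 1 + v <= exp v. Every comparison of a sum with an integral below is a telescoping use of them. *)
Lemma powRN_diff_bounds (R : realType) (b x y : R) : 0 <= b -> 0 < x -> x <= y ->
  b * (y - x) * (y `^ (b + 1))^-1 <= (x `^ b)^-1 - (y `^ b)^-1
    <= b * (y - x) * (x `^ (b + 1))^-1.
Proof.
move=> b0 x0 xy; have y0 : 0 < y by exact: lt_le_trans xy.
have xN := gt_eqF x0; have yN := gt_eqF y0.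
set L := ln (y / x).
have yx : y = x * (y / x) by rewrite mulrCA divff ?xN // mulr1.
have yxb : y `^ b = x `^ b * expR (b * L).
  rewrite {1}yx powRM ?divr_ge0 ?ltW //; congr (_ * _).
  by rewrite /powR gt_eqF ?divr_gt0.
have L1 : L <= y / x - 1.
  have := @le_ln1Dx R (y / x - 1); rewrite [1 + _]addrC subrK; apply.
  by rewrite ltrBrDr addNr divr_gt0.
have L2 : 1 - x / y <= L.
  have := @le_ln1Dx R (x / y - 1); rewrite [1 + _]addrC subrK.
  have -> : ln (x / y) = - L.
    by rewrite /L -[x / y]invf_div lnV ?posrE ?divr_gt0.
  move=> h; have {h} := h _; rewrite ltrBrDr addNr divr_gt0 // => /(_ isT).
  by lra.
have xb0 : 0 < x `^ b by exact: powR_gt0.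
have yb0 : 0 < y `^ b by exact: powR_gt0.
have pd (u : R) : 0 < u -> u `^ (b + 1) = u `^ b * u.
  by move=> u0; rewrite powRD ?(gt_eqF u0) ?implybT // powRr1 // ltW.
rewrite !pd //; apply/andP; split.
- have -> : b * (y - x) * (y `^ b * y)^-1 = (y `^ b)^-1 * (b * (1 - x / y)).
    by field; rewrite !gt_eqF.
  have -> : (x `^ b)^-1 = (y `^ b)^-1 * expR (b * L).
    by rewrite yxb; field; rewrite !gt_eqF ?expR_gt0.
  rewrite -[X in _ <= _ - X]mulr1 -mulrBr ler_pM2l ?invr_gt0 //.
  have := expR_ge1Dx (b * L); have := ler_wpM2l b0 L2; lra.
- have -> : b * (y - x) * (x `^ b * x)^-1 = (x `^ b)^-1 * (b * (y / x - 1)).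
    by field; rewrite !gt_eqF.
  have -> : (y `^ b)^-1 = (x `^ b)^-1 * expR (- (b * L)).
    by rewrite yxb expRN; field; rewrite !gt_eqF ?expR_gt0.
  rewrite -[X in X - _]mulr1 -mulrBr ler_pM2l ?invr_gt0 //.
  have := expR_ge1Dx (- (b * L)); have := ler_wpM2l b0 L1; lra.
Qed.

Definition dsum (R : realType) (F : nat -> R) (z : R) (m : nat) : R :=
  \sum_(1 <= n < m) F n * (n%:R `^ z)^-1.

(** For coefficients bounded by a constant and z > 1 the partial sums converge
absolutely; the series is only used there. *)
Definition dseries (R : realType) (F : nat -> R) (z : R) : R :=
  limn (dsum F z).

Lemma invpowR_ge0 (R : realType) (x z : R) : 0 <= (x `^ z)^-1.
Proof. by rewrite invr_ge0 powR_ge0. Qed.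

Lemma powR_ge1 (R : realType) (x z : R) : 1 <= x -> 0 <= z -> 1 <= x `^ z.
Proof. by move=> x1 z0; rewrite -[leLHS](powRr0 x) ler_powR. Qed.

Lemma ler_dsum (R : realType) (F G : nat -> R) (z : R) m :
  (forall n, (0 < n)%N -> F n <= G n) -> dsum F z m <= dsum G z m.
Proof.
move=> FG; rewrite /dsum big_nat [leRHS]big_nat; apply: ler_sum => n /andP[n0 _].
by rewrite ler_wpM2r ?invpowR_ge0 ?FG.
Qed.

Lemma eq_dsum (R : realType) (F G : nat -> R) (z : R) m :
  (forall n, (0 < n)%N -> F n = G n) -> dsum F z m = dsum G z m.
Proof. by move=> FG; apply/eqP; rewrite eq_le !ler_dsum // => n /FG ->. Qed.

Lemma ler_norm_dsum (R : realType) (F G : nat -> R) (z : R) m :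
  (forall n, (0 < n)%N -> `|F n| <= G n) -> `|dsum F z m| <= dsum G z m.
Proof.
move=> FG; rewrite ler_norml; apply/andP; split.
  rewrite /dsum -sumrN big_nat [leRHS]big_nat; apply: ler_sum => n /andP[n0 _].
  rewrite -mulNr ler_wpM2r ?invpowR_ge0 //.
  by have := FG n n0; rewrite ler_norml => /andP[].
apply: ler_dsum => n n0; apply: le_trans (FG n n0); exact: ler_norm.
Qed.

Lemma dsumD (R : realType) (F G : nat -> R) (z : R) m :
  dsum (fun n => F n + G n) z m = dsum F z m + dsum G z m.
Proof. by rewrite /dsum -big_split /=; apply: eq_bigr => n _; rewrite mulrDl. Qed.

Lemma dsumZ (R : realType) c (F : nat -> R) (z : R) m :
  dsum (fun n => c * F n) z m = c * dsum F z m.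
Proof. by rewrite /dsum mulr_sumr; apply: eq_bigr => n _; rewrite mulrA. Qed.

(** Cutting at multiples of Q groups the terms by residue class modulo Q, with
representatives 1, ..., Q since the sum starts at 1. *)
Lemma dsum_block (R : realType) (F : nat -> R) (z : R) Q J :
  dsum F z (J * Q).+1 =
    \sum_(1 <= r < Q.+1) \sum_(j < J) F (r + j * Q)%N * ((r + j * Q)%:R `^ z)^-1.
Proof.
elim: J => [|J IH].
  by rewrite mul0n /dsum big_geq // big1 // => r _; rewrite big_ord0.
rewrite /dsum (@big_cat_nat _ _ _ (J * Q).+1) //=; last by rewrite ltnS leq_mul2r leqnSn orbT.
rewrite -/(dsum F z (J * Q).+1) IH.
under [RHS]eq_bigr => r _ do rewrite big_ord_recr /=.
rewrite big_split /=; congr (_ + _).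
by rewrite -{1}[(J * Q).+1]add1n big_addn mulSn -addSn addnK.
Qed.

(** The leading 1 bounds the telescoping sum, and (z - 1) * Q pays for the first
term, which has no predecessor in the progression. *)
Lemma progression_sum_le (R : realType) (z : R) r Q J : 1 < z -> (0 < r)%N ->
  (z - 1) * Q%:R * (\sum_(j < J) ((r + j * Q)%:R `^ z)^-1) <= 1 + (z - 1) * Q%:R.
Proof.
move=> z1 r0.
have rg1 n : (1 : R) <= (r + n)%:R by rewrite ler1n ltn_addr.
suff : (z - 1) * Q%:R * (\sum_(j < J.+1) ((r + j * Q)%:R `^ z)^-1)
     <= 1 + (z - 1) * Q%:R - ((r + J * Q)%:R `^ (z - 1))^-1.
  move=> h; apply: (le_trans _ (le_trans h _)); last by rewrite gerBl invpowR_ge0.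
  apply: ler_wpM2l; first by rewrite mulr_ge0 // subr_ge0 ltW.
  by rewrite big_ord_recr /= lerDl invpowR_ge0.
have zq : 0 <= (z - 1) * Q%:R by rewrite mulr_ge0 // subr_ge0 ltW.
elim: J => [|J IH].
  rewrite big_ord1 /= mul0n addn0.
  have : (r%:R `^ z)^-1 <= 1 :> R.
    by rewrite invf_le1 ?powR_gt0 ?ltr0n // powR_ge1 ?ler1n //; lra.
  have : (r%:R `^ (z - 1))^-1 <= 1 :> R.
    by rewrite invf_le1 ?powR_gt0 ?ltr0n // powR_ge1 ?ler1n //; lra.
  move=> h1 h2; have := ler_wpM2l zq h2; lra.
rewrite big_ord_recr mulrDr /=.
have := @powRN_diff_bounds R (z - 1) (r + J * Q)%:R (r + J.+1 * Q)%:R.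
have := rg1 (J * Q)%N => /(lt_le_trans ltr01) -> /=.
rewrite subr_ge0 ltW // ler_nat leq_add2l leq_mul2r leqnSn orbT => /(_ isT isT isT).
rewrite subrK -natrB ?leq_add2l ?leq_mul2r ?leqnSn ?orbT //.
rewrite subnDl mulSn addnK => /andP[h _]; move: IH h; lra.
Qed.

Lemma progression_sum_ge (R : realType) (z : R) r Q J : 1 < z -> (0 < r)%N ->
  (r%:R `^ (z - 1))^-1 - ((r + J * Q)%:R `^ (z - 1))^-1
    <= (z - 1) * Q%:R * (\sum_(j < J) ((r + j * Q)%:R `^ z)^-1).
Proof.
move=> z1 r0.
elim: J => [|J IH]; first by rewrite mul0n addn0 subrr big_ord0 mulr0.
rewrite big_ord_recr mulrDr /=.
have := @powRN_diff_bounds R (z - 1) (r + J * Q)%:R (r + J.+1 * Q)%:R.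
rewrite subr_ge0 ltW // ltr0n ltn_addr //.
rewrite ler_nat leq_add2l leq_mul2r leqnSn orbT => /(_ isT isT isT).
rewrite subrK -natrB ?leq_add2l ?leq_mul2r ?leqnSn ?orbT //.
rewrite subnDl mulSn addnK => /andP[_ h]; move: IH h; lra.
Qed.

Lemma dsum1_le (R : realType) (z : R) m : 1 < z ->
  (z - 1) * dsum (fun=> 1) z m <= z.
Proof.
move=> z1; case: m => [|m]; first by rewrite /dsum big_geq // mulr0; lra.
have := @progression_sum_le R z 1 1 m z1 isT.
have -> : dsum (fun=> 1) z m.+1 = dsum (fun=> 1 : R) z (m * 1).+1 by rewrite muln1.
rewrite dsum_block big_nat1 mulr1 [1 + (z - 1)]addrC subrK => h.
by under eq_bigr do rewrite mul1r.
Qed.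

Lemma invpowR_cvg0 (R : realType) (b : R) : 0 < b ->
  ((n%:R `^ b)^-1 : R) @[n --> \oo] --> 0.
Proof.
move=> b0; apply/cvgrPdist_le => e e0; near=> n.
have n0 : (0 : R) < n%:R by rewrite ltr0n; near: n; exists 1%N.
rewrite sub0r normrN ger0_norm ?invpowR_ge0 // invf_ple ?posrE ?powR_gt0 //.
have -> : e^-1 = (e^-1 `^ b^-1) `^ b.
  by rewrite -powRrM mulVf ?gt_eqF // powRr1 // invr_ge0 ltW.
apply: ge0_ler_powR; rewrite ?nnegrE ?powR_ge0 ?ltW //.
near: n; apply: nbhs_infty_gtr.
Unshelve. all: by end_near. Qed.

Lemma dsum_cvg (R : realType) (F : nat -> R) (z c : R) : 1 < z ->
  (forall n, `|F n| <= c) -> dsum F z @ \oo --> dseries F z.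
Proof.
move=> z1 Fc.
have c0 : 0 <= c by apply: le_trans (Fc 0%N).
have E : dsum F z = series (fun n => F n * (n%:R `^ z)^-1).
  apply/funext => -[|m]; first by rewrite /dsum /series /= !big_geq.
  rewrite /dsum /series /= [RHS]big_ltn // powR0 ?invr0 ?mulr0 ?add0r //.
  by rewrite gt_eqF //; lra.
suff : cvgn (dsum F z) by [].
rewrite E; apply: normed_cvg.
apply: nondecreasing_is_cvgn.
  by apply: nondecreasing_series => n _ _ /=.
exists (c * (z / (z - 1))) => _ [m _ <-] /=.
apply: le_trans (_ : c * dsum (fun=> 1) z m <= _); last first.
  rewrite ler_wpM2l // ler_pdivlMr ?subr_gt0 // mulrC; exact: dsum1_le.
rewrite -dsumZ /series /=.
case: m => [|m]; first by rewrite /dsum !big_geq.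
rewrite big_ltn // powR0 ?invr0 ?mulr0 ?normr0 ?add0r ?gt_eqF //; last lra.
apply: ler_sum => n _; rewrite normrM (ger0_norm (invpowR_ge0 _ _)).
by rewrite ler_wpM2r ?invpowR_ge0 // mulr1.
Qed.

Lemma dsum_cvg_block (R : realType) (F : nat -> R) (z c : R) Q : 1 < z ->
  (forall n, `|F n| <= c) -> (0 < Q)%N ->
  dsum F z (J * Q).+1 @[J --> \oo] --> dseries F z.
Proof.
move=> z1 Fc Q0; apply: cvg_comp (dsum_cvg z1 Fc).
move=> A [n _ nA]; exists n => // J /= nJ; apply: nA => /=.
by rewrite (leq_trans nJ) // (leq_trans (leq_pmulr J Q0)).
Qed.

Lemma dseries_le (R : realType) (F : nat -> R) (z c b : R) : 1 < z ->
  (forall n, `|F n| <= c) -> (forall m, dsum F z m <= b) -> dseries F z <= b.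
Proof.
move=> z1 Fc h; have := dsum_cvg z1 Fc => hc.
rewrite /dseries; apply: limr_le; first by apply/cvg_ex; eexists; exact: hc.
by near=> n; exact: h.
Unshelve. all: by end_near. Qed.

Lemma dseries_ge (R : realType) (F : nat -> R) (z c b : R) : 1 < z ->
  (forall n, `|F n| <= c) -> (forall m, (0 < m)%N -> b <= dsum F z m) -> b <= dseries F z.
Proof.
move=> z1 Fc h; have := dsum_cvg z1 Fc => hc.
rewrite /dseries; apply: limr_ge; first by apply/cvg_ex; eexists; exact: hc.
by near=> n; apply: h; near: n; exists 1%N.
Unshelve. all: by end_near. Qed.

Lemma dseriesD (R : realType) (F G : nat -> R) (z c d : R) : 1 < z ->
  (forall n, `|F n| <= c) -> (forall n, `|G n| <= d) ->
  dseries (fun n => F n + G n) z = dseries F z + dseries G z.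
Proof.
move=> z1 hF hG; rewrite {1}/dseries; apply: cvg_lim => //.
have -> : dsum (fun n => F n + G n) z = dsum F z \+ dsum G z.
  by apply/funext => m; rewrite dsumD.
by apply: cvgD; [exact: dsum_cvg hF|exact: dsum_cvg hG].
Qed.

Lemma dseriesZ (R : realType) (F : nat -> R) (z c d : R) : 1 < z ->
  (forall n, `|F n| <= c) -> dseries (fun n => d * F n) z = d * dseries F z.
Proof.
move=> z1 hF; rewrite {1}/dseries; apply: cvg_lim => //.
have -> : dsum (fun n => d * F n) z = (fun m => d * dsum F z m).
  by apply/funext => m; rewrite dsumZ.
by apply: cvgMl_tmp; exact: dsum_cvg hF.
Qed.

Lemma eq_dseries (R : realType) (F G : nat -> R) (z : R) :
  (forall n, (0 < n)%N -> F n = G n) -> dseries F z = dseries G z.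
Proof.
by move=> FG; rewrite /dseries; congr (limn _); apply/funext => m; exact: eq_dsum.
Qed.

(** * Peeling, periodic coefficients and Abel summation *)

Lemma dsum_dvd (R : realType) (F : nat -> R) (z : R) d M : (0 < d)%N ->
  dsum (fun n => if (d %| n)%N then F n else 0) z (M * d).+1 =
    (d%:R `^ z)^-1 * dsum (fun k => F (k * d)%N) z (M * 1).+1.
Proof.
move=> d0; rewrite !dsum_block big_nat1 big_nat_recr //= big_nat big1 ?add0r.
  rewrite mulr_sumr; apply: eq_bigr => j _.
  rewrite dvdn_addr // dvdn_mull // mulnDl mul1n muln1 mulrCA; congr (_ * _).
  by rewrite -invfM -powRM // -natrM mulnDr muln1 mulnC.
move=> r /andP[r0 rd]; apply: big1 => j _.
by rewrite dvdn_addl ?dvdn_mull // gtnNdvd // mul0r.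
Qed.

Lemma dseries_dvd (R : realType) (F : nat -> R) (z c : R) d : 1 < z ->
  (forall n, `|F n| <= c) -> (0 < d)%N ->
  dseries (fun n => if (d %| n)%N then F n else 0) z =
    (d%:R `^ z)^-1 * dseries (fun k => F (k * d)%N) z.
Proof.
move=> z1 Fc d0.
have Gc n : `|if (d %| n)%N then F n else 0| <= c.
  by case: ifP => // _; rewrite normr0 (le_trans _ (Fc 0%N)).
have h1 := dsum_cvg_block z1 Gc d0.
have h2 := @dsum_cvg_block R (fun k => F (k * d)%N) z c 1 z1 (fun k => Fc _) isT.
have := cvgMl_tmp (a := (d%:R `^ z)^-1) h2.
under eq_fun do rewrite -dsum_dvd //.
by move=> h; rewrite -[LHS](cvg_lim (@Rhausdorff R) h1) (cvg_lim (@Rhausdorff R) (h _)).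
Qed.

Lemma dseries_peel (R : realType) (F : nat -> R) (z c : R) d : 1 < z ->
  (forall n, `|F n| <= c) -> (0 < d)%N ->
  dseries F z = dseries (fun n => if (d %| n)%N then 0 else F n) z
    + (d%:R `^ z)^-1 * dseries (fun k => F (k * d)%N) z.
Proof.
move=> z1 Fc d0; have c0 : 0 <= c by apply: le_trans (Fc 0%N).
rewrite -(dseries_dvd z1 Fc d0) -(@dseriesD _ _ _ _ c c) //.
- by apply: eq_dseries => n _; case: ifP; rewrite ?add0r ?addr0.
- by move=> n; case: ifP; rewrite ?normr0.
- by move=> n; case: ifP; rewrite ?normr0.
Qed.

(** A finite form of the Euler factor at d: the geometric remainder is kept, so
that no interchange of limits is needed. *)
Lemma dseries_peel_iter (R : realType) (F : nat -> R) (z c : R) d J : 1 < z ->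
  (forall n, `|F n| <= c) -> (0 < d)%N ->
  dseries F z =
    \sum_(j < J) (d%:R `^ z)^-1 ^+ j *
       dseries (fun n => if (d %| n)%N then 0 else F (n * d ^ j)%N) z
    + (d%:R `^ z)^-1 ^+ J * dseries (fun k => F (k * d ^ J)%N) z.
Proof.
move=> z1 Fc d0; elim: J => [|J IH].
  rewrite big_ord0 add0r expr0 mul1r.
  by apply: eq_dseries => n _; rewrite expn0 muln1.
rewrite big_ord_recr /= -addrA {1}IH; congr (_ + _).
rewrite (@dseries_peel _ _ _ c d z1) // mulrDr; congr (_ + _).
rewrite mulrA -exprSr; congr (_ * _).
by apply: eq_dseries => n _; rewrite expnS mulnA.
Qed.

Lemma ler_norm_dseries (R : realType) (F : nat -> R) (z c : R) : 1 < z ->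
  (forall n, `|F n| <= c) -> `|dseries F z| <= c * (z / (z - 1)).
Proof.
move=> z1 Fc; have c0 : 0 <= c by apply: le_trans (Fc 0%N).
have h m : `|dsum F z m| <= c * (z / (z - 1)).
  apply: (@le_trans _ _ (dsum (fun=> c * 1) z m)).
    by apply: ler_norm_dsum => n _; rewrite mulr1.
  rewrite dsumZ ler_wpM2l // ler_pdivlMr ?subr_gt0 // mulrC; exact: dsum1_le.
rewrite ler_norml; apply/andP; split.
  by apply: (dseries_ge z1 Fc) => m _; have := h m; rewrite ler_norml => /andP[].
by apply: (dseries_le z1 Fc) => m; have := h m; rewrite ler_norml => /andP[].
Qed.

(** Used to discard the remainder of the peeling identity. *)
Lemma le_of_geometric_error (R : realType) (x y B q : R) : 0 <= q < 1 ->
  (forall J, (2 <= J)%N -> x <= y + q ^+ J * B) -> x <= y.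
Proof.
move=> /andP[q0 q1] h.
have hc : (y + q ^+ J * B) @[J --> \oo] --> y.
  rewrite -[X in _ --> X]addr0 -(mul0r B); apply: cvgD; first exact: cvg_cst.
  by apply: cvgMr_tmp; apply: cvg_expr; rewrite ger0_norm.
rewrite -(cvg_lim _ hc) //; apply: limr_ge; first by apply/cvg_ex; exists y.
by near=> J; apply: h; near: J; exists 2%N.
Unshelve. all: by end_near. Qed.

(** Each residue class modulo Q contributes 1 / Q to the limit as z -> 1+; the
bound makes the error explicit, which lets z and the period vary together
later. *)
Lemma dseries_periodic (R : realType) (v : nat -> R) (z : R) Q : 1 < z ->
  (0 < Q)%N -> (forall n, `|v n| <= 1) -> (forall n, v (n + Q)%N = v n) ->
  `|(z - 1) * Q%:R * dseries v z - \sum_(1 <= r < Q.+1) v r|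
    <= (z - 1) * Q%:R ^+ 2.
Proof.
move=> z1 Q0 v1 vQ.
have vj r j : v (r + j * Q)%N = v r.
  by elim: j => [|j IH]; rewrite ?mul0n ?addn0 // mulSn addnCA addnC vQ.
have zm : 0 < z - 1 by rewrite subr_gt0.
have h J : (0 < J)%N ->
  `|(z - 1) * Q%:R * dsum v z (J * Q).+1 - \sum_(1 <= r < Q.+1) v r|
    <= (z - 1) * Q%:R ^+ 2 + Q%:R * (J%:R `^ (z - 1))^-1.
  move=> J0; rewrite dsum_block mulr_sumr -sumrB.
  apply: le_trans (ler_norm_sum _ _ _) _.
  apply: (@le_trans _ _ (\sum_(1 <= r < Q.+1)
      ((z - 1) * Q%:R + (J%:R `^ (z - 1))^-1))); last first.
    by rewrite sumr_const_nat subSS subn0 -[leLHS]mulr_natl; lra.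
  rewrite big_nat [leRHS]big_nat; apply: ler_sum => r /andP[r0 rQ].
  under eq_bigr => j _ do rewrite vj.
  rewrite -mulr_sumr mulrCA -[X in _ - X]mulr1 -mulrBr normrM.
  rewrite -[leRHS]mul1r ler_pM // ler_norml.
  have := @progression_sum_le R z r Q J z1 r0.
  have := @progression_sum_ge R z r Q J z1 r0.
  have h1 : 1 - (z - 1) * Q%:R <= (r%:R `^ (z - 1))^-1.
    have r1 : (1 : R) <= r%:R by rewrite ler1n.
    have := @powRN_diff_bounds R (z - 1) 1 r%:R (ltW zm) ltr01 r1.
    rewrite !powR1 invr1 mulr1 => /andP[_ h1].
    have h2 : (z - 1) * (r%:R - 1) <= (z - 1) * Q%:R.
      by rewrite ler_pM2l // lerBlDr (le_trans (_ : _ <= Q%:R)) ?ler_nat ?lerDl.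
    lra.
  have h2 : ((r + J * Q)%:R `^ (z - 1))^-1 <= (J%:R `^ (z - 1))^-1 :> R.
    rewrite lef_pV2 ?posrE ?powR_gt0 ?ltr0n ?ltn_addr //.
    apply: ge0_ler_powR; rewrite ?nnegrE ?ler0n // ?ler_nat ?(ltW zm) //.
    by rewrite (leq_trans (leq_pmulr J Q0)) // leq_addl.
  have := @invpowR_ge0 R J%:R (z - 1).
  move=> h3 h4 h5; apply/andP; split; lra.
have cv := dsum_cvg_block z1 v1 Q0.
have cl : `|(z - 1) * Q%:R * dsum v z (J * Q).+1 - \sum_(1 <= r < Q.+1) v r|
   @[J --> \oo] --> `|(z - 1) * Q%:R * dseries v z - \sum_(1 <= r < Q.+1) v r|.
  by apply: cvg_norm; apply: cvgB; [apply: cvgMl_tmp|exact: cvg_cst].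
have cr : (z - 1) * Q%:R ^+ 2 + Q%:R * (J%:R `^ (z - 1))^-1 @[J --> \oo]
   --> (z - 1) * Q%:R ^+ 2.
  rewrite -[X in _ --> X]addr0 -(mulr0 Q%:R).
  by apply: cvgD; [exact: cvg_cst|apply: cvgMl_tmp; exact: invpowR_cvg0].
rewrite -(cvg_lim _ cl) // -(cvg_lim _ cr) //.
apply: ler_lim; [by apply/cvg_ex; eexists; exact: cl|by apply/cvg_ex; eexists; exact: cr|].
by near=> J; apply: h; near: J; exists 1%N.
Unshelve. all: by end_near. Qed.

(** After summation by parts the general term is at most
C n^(1-beta) z n^(-z-1) <= 2 C n^(-1-beta), whose sum is bounded independently
of z in [1, 2]. A one-sided hypothesis suffices because n^(-z) decreases. *)
Lemma abel_summation_le (R : realType) (b : nat -> R) (C beta z : R) m :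
  0 < beta -> beta < 1 -> 0 <= C -> 1 <= z -> z <= 2 ->
  (forall n, (0 < n)%N -> \sum_(1 <= i < n.+1) b i <= C * n%:R `^ (1 - beta)) ->
  dsum b z m <= C + 2 * C * ((1 + beta) / beta).
Proof.
move=> b0 b1 C0 z1 z2 hS.
have CK : 0 <= 2 * C * ((1 + beta) / beta).
  by rewrite !mulr_ge0 ?invr_ge0 ?addr_ge0 // ltW.
case: m => [|[|m]]; try by rewrite /dsum big_geq // addr_ge0.
have parts : dsum b z m.+2 = (\sum_(1 <= i < m.+2) b i) * (m.+2%:R `^ z)^-1 +
   \sum_(1 <= n < m.+2) (\sum_(1 <= i < n.+1) b i) *
      ((n%:R `^ z)^-1 - (n.+1%:R `^ z)^-1).
  elim: m => [|m IH]; first by rewrite /dsum !big_nat1; ring.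
  rewrite /dsum big_nat_recr //= -/(dsum b z m.+2) IH.
  have E : \sum_(1 <= i < m.+3) b i = \sum_(1 <= i < m.+2) b i + b m.+2.
    by rewrite big_nat_recr.
  by rewrite [X in _ = _ + X]big_nat_recr //= !E; ring.
rewrite parts; apply: lerD.
  apply: le_trans (_ : C * m.+1%:R `^ (1 - beta) * (m.+2%:R `^ z)^-1 <= _).
    by rewrite ler_wpM2r ?invpowR_ge0 ?hS.
  rewrite -mulrA -[leRHS]mulr1 ler_wpM2l // ler_pdivrMr ?powR_gt0 // mul1r.
  apply: le_trans (_ : m.+1%:R `^ z <= _).
    by apply: ler_powR; rewrite ?ler1n //; lra.
  by apply: ge0_ler_powR; rewrite ?nnegrE ?ler_nat //; lra.
have zb : (1 : R) < 1 + beta by lra.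
have := @dsum1_le R (1 + beta) m.+2 zb; rewrite [1 + beta - 1]addrC addKr => hd.
apply: (@le_trans _ _ (2 * C * dsum (fun=> 1) (1 + beta) m.+2)); last first.
  rewrite ler_wpM2l ?mulr_ge0 // ler_pdivlMr // mulrC; exact: hd.
rewrite /dsum mulr_sumr big_nat [leRHS]big_nat.
apply: ler_sum => n /andP[n0 _]; rewrite mul1r.
have nR : (0 : R) < n%:R by rewrite ltr0n.
have n1 : (1 : R) <= n%:R by rewrite ler1n.
have nn : (n%:R : R) <= n.+1%:R by rewrite ler_nat.
have zz : 0 <= z by lra.
have /andP[dl du] := @powRN_diff_bounds R z n%:R n.+1%:R zz nR nn.
have d0 : 0 <= (n%:R `^ z)^-1 - (n.+1%:R `^ z)^-1.
  by apply: le_trans dl; rewrite !mulr_ge0 ?invpowR_ge0 // subr_ge0.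
apply: le_trans (_ : C * n%:R `^ (1 - beta) * (z * (n%:R `^ (z + 1))^-1) <= _).
  apply: le_trans (ler_wpM2r d0 (hS n n0)) _.
  apply: ler_wpM2l; first by rewrite mulr_ge0 ?powR_ge0.
  by move: du; rewrite -natrB // subSnn mulr1.
have -> : C * n%:R `^ (1 - beta) * (z * (n%:R `^ (z + 1))^-1) =
   z * C * (n%:R `^ (1 - beta) * (n%:R `^ (z + 1))^-1) by ring.
rewrite ler_pM ?mulr_ge0 ?powR_ge0 ?invpowR_ge0 //; first by rewrite ler_wpM2r.
rewrite -!powRN -powRD; last by rewrite (gt_eqF nR) implybT.
by apply: ler_powR => //; lra.
Qed.

(** * The Sato-Tate measure of intervals *)

Lemma within_continuous_semicircle (R : realType) (u v : R) :
  {within `[u, v], continuous (fun x : R => 2 / pi * Num.sqrt (1 - x ^+ 2))}.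
Proof.
apply: continuous_subspaceT => x.
apply: cvgMl_tmp; apply: (cvg_comp (fun x => 1 - x ^+ 2) Num.sqrt).
  by apply: cvgB; [exact: cvg_cst|exact: exprn_continuous].
exact: sqrt_continuous.
Qed.

Lemma integrable_semicircle (R : realType) (u v : R) :
  (@lebesgue_measure R).-integrable `[u, v]
    (EFin \o (fun x : R => 2 / pi * Num.sqrt (1 - x ^+ 2))).
Proof.
apply: continuous_compact_integrable; first exact: segment_compact.
exact: within_continuous_semicircle.
Qed.

Lemma sato_tate_itv (R : realType) (u v : R) : -1 <= u -> v <= 1 ->
  sato_tate `[u, v] =
    \int[lebesgue_measure]_(x in `[u, v]) (2 / pi * Num.sqrt (1 - x ^+ 2)).
Proof.
move=> u1 v1; rewrite /sato_tate setIidl //.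
by move=> x /=; rewrite !in_itv /= => /andP[ux xv]; rewrite (le_trans u1 ux) (le_trans xv v1).
Qed.

(** The density is at most 2 / pi <= 1. *)
Lemma sato_tate_itv_le (R : realType) (u v : R) : -1 <= u -> u <= v -> v <= 1 ->
  sato_tate `[u, v] <= v - u.
Proof.
move=> u1 uv v1; rewrite sato_tate_itv //.
have -> : v - u = \int[lebesgue_measure]_(x in `[u, v]) (1 : R).
  rewrite Rintegral_cst //= lebesgue_measure_itv /= lte_fin mul1r.
  by case: ltP => [//|vu]; rewrite (@le_anti _ _ u v) ?uv ?vu // subrr.
apply: le_Rintegral => //; first exact: integrable_semicircle.
  apply: continuous_compact_integrable; first exact: segment_compact.
  by apply: continuous_subspaceT => x; exact: cvg_cst.
move=> x _; rewrite -[leRHS]mulr1 ler_pM ?divr_ge0 ?pi_ge0 ?sqrtr_ge0 //.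
  by rewrite ler_pdivrMr ?pi_gt0 // mul1r pi_ge2.
by rewrite -[leRHS]sqrtr1 ler_sqrt // gerBl sqr_ge0.
Qed.

(** The derivative of asin blows up at the end points, where continuity must
come from sin being a homeomorphism of the closed interval. *)
Lemma within_continuous_asin (R : realType) :
  {within `[(-1), 1], continuous (@asin R)}.
Proof.
have := @segment_can_le_continuous R (- (pi / 2)) (pi / 2) sin (@asin R).
rewrite sinN sin_pihalf; apply; last exact: sinK.
  by rewrite -subr_ge0 opprK addr_ge0 // divr_ge0 // pi_ge0.
by apply: continuous_subspaceT; exact: continuous_sin.
Qed.

(** The antiderivative of sqrt (1 - x^2) is (x sqrt (1 - x^2) + asin x) / 2. *)
Lemma sato_tate_left_half (R : realType) : sato_tate `[(-1 : R), 0] = 1 / 2.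
Proof.
have N10 : (-1 : R) < 0 by lra.
rewrite sato_tate_itv ?ler01 ?lexx //.
pose F (x : R) := pi^-1 * (x * Num.sqrt (1 - x ^+ 2) + asin x).
have derF (x : R) : -1 < x -> x < 0 ->
    is_derive x 1 F (2 / pi * Num.sqrt (1 - x ^+ 2)).
  move=> x1 x0.
  have s0 : 0 < 1 - x ^+ 2 by nra.
  have xx : -1 < x < 1 by apply/andP; split; lra.
  have dq : is_derive x 1 (fun x : R => 1 - x ^+ 2) (- (2 * x)).
    apply: is_derive_eq; rewrite /GRing.scale /=; ring.
  have ds : is_derive x 1 (fun x : R => Num.sqrt (1 - x ^+ 2))
      ((2 * Num.sqrt (1 - x ^+ 2))^-1 * (- (2 * x))).
    have d1 := is_derive1_sqrt s0.
    by apply: (@is_derive1_comp R Num.sqrt (fun x => 1 - x ^+ 2)).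
  apply: is_derive_eq; rewrite /GRing.scale /=.
  have q0 : 0 < Num.sqrt (1 - x ^+ 2) by rewrite sqrtr_gt0.
  have qq : Num.sqrt (1 - x ^+ 2) ^+ 2 = 1 - x ^+ 2 by rewrite sqr_sqrtr // ltW.
  have p0 : (pi : R) != 0 by rewrite gt_eqF ?pi_gt0.
  have key (P q : R) : P != 0 -> 0 < q -> q ^+ 2 = 1 - x ^+ 2 ->
      P^-1 * (x * ((2 * q)^-1 * - (2 * x)) + q * 1 + q^-1) = 2 / P * q.
    move=> P0 q1 q2; transitivity (P^-1 * ((1 - x ^+ 2) + q ^+ 2) / q).
      by field; rewrite P0 gt_eqF.
    by rewrite -q2; field; rewrite P0 gt_eqF.
  exact: key.
rewrite /Rintegral (@continuous_FTC2 _ _ F) //.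
- rewrite /F mul0r -EFinB /= sqrrN expr1n subrr sqrtr0 mulr0 !add0r.
  have p2 : (0 : R) <= pi / 2 by rewrite divr_ge0 ?pi_ge0.
  have I0 : (0 : R) \in `[(- (pi / 2)), (pi / 2)] by rewrite in_itv /= oppr_le0 p2.
  have I1 : - (pi / 2) \in `[(- (pi / 2)), (pi / 2 : R)].
    by rewrite in_itv /= lexx -subr_ge0 opprK addr_ge0.
  have := sinK I0; rewrite sin0 => ->; have := sinK I1; rewrite sinN sin_pihalf => ->.
  have := @pi_gt0 R; move: (pi : R) => P P0.
  by field; rewrite gt_eqF.
- exact: within_continuous_semicircle.
- have cF : {within `[(-1 : R), 0], continuous F}.
    move=> x; apply: cvgMl_tmp; apply: cvgD.
      apply: (@continuous_subspaceT R R `[(-1 : R), 0]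
        (fun y => y * Num.sqrt (1 - y ^+ 2))) => y.
      apply: cvgM; first exact: cvg_id.
      apply: (cvg_comp (fun x => 1 - x ^+ 2) Num.sqrt).
        by apply: cvgB; [exact: cvg_cst|exact: exprn_continuous].
      exact: sqrt_continuous.
    have : {within `[(-1 : R), 0], continuous asin}.
      apply: continuous_subspaceW (@within_continuous_asin R).
      by move=> y /=; rewrite !in_itv /= => /andP[-> /le_trans]; apply.
    by apply.
  have [_ h1 h2] := (continuous_within_itvP _ N10).1 cF.
  split=> // x xI; have /andP[x1 x0] : -1 < x < 0 by move: xI; rewrite in_itv.
  by case: (derF x x1 x0).
move=> x; rewrite in_itv /= => /andP[x1 x0].
by rewrite derive1E; case: (derF x x1 x0).
Qed.

Lemma sato_tate_left_ge (R : realType) (w : R) : 0 <= w -> w <= 1 ->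
  1 / 2 - w <= sato_tate `[-1, - w].
Proof.
move=> w0 w1.
have Nw : - w <= 0 by lra.
have N1 : -1 <= - w by lra.
have h := @sato_tate_itv_le R (- w) 0 N1 Nw ler01.
rewrite -sato_tate_left_half !sato_tate_itv ?lexx ?ler01 //; last lra.
rewrite lerBlDr -lerBlDl Rintegral_itvB //; first last.
- exact: integrable_semicircle.
rewrite Rintegral_itv_obnd_cbnd; last first.
  apply: integrableS (@integrable_semicircle R (-w) 0) => //.
  exact: subset_itv_oc_cc.
by move: h; rewrite sato_tate_itv // opprK add0r.
Qed.

(** * Multiplicativity of the coefficients at square classes *)

Lemma legendre_residueP (b : int) (p : nat) : (0 < p)%N ->
  reflect (exists y : int, (y ^+ 2 = b %[mod p%:Z])%Z)
    [exists x : 'I_p, (x%:Z ^+ 2 == b %[mod p%:Z])%Z].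
Proof.
move=> p0; apply: (iffP existsP) => [[x /eqP xb]|[y yb]]; first by exists x.
have pz : p%:Z != 0 by rewrite eqz_nat -lt0n.
have yp : (`|(y %% p%:Z)%Z| < p)%N.
  have := ltz_pmod y (_ : 0 < p%:Z); have := modz_ge0 y pz; lia.
exists (Ordinal yp) => /=; apply/eqP.
by rewrite gez0_abs ?modz_ge0 // modzXm.
Qed.

(** An inverse of m modulo p turns a square root of b m^2 into one of b. *)
Lemma legendre_mul_sqr (b : int) (m p : nat) : prime p -> ~~ (p %| m)%N ->
  legendre (b * m%:Z ^+ 2) p = legendre b p.
Proof.
move=> pp pm; have p0 := prime_gt0 pp.
have cpm : coprimez p%:Z m%:Z by rewrite coprimezE /= prime_coprime.
have cpm2 : coprimez p%:Z (m%:Z ^+ 2) by rewrite coprimezXr.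
rewrite /legendre Gauss_dvdzl //; case: ifP => // _.
suff -> : [exists x : 'I_p, (x%:Z ^+ 2 == b * m%:Z ^+ 2 %[mod p%:Z])%Z] =
          [exists x : 'I_p, (x%:Z ^+ 2 == b %[mod p%:Z])%Z] by [].
apply/idP/idP => /(legendre_residueP _ p0) [y yb]; apply/(legendre_residueP _ p0).
- have /coprimezP [[u v] /= uv] := cpm.
  exists (y * v); rewrite exprMn -(modzMml (y ^+ 2)) yb modzMml -mulrA -exprMn.
  have -> : m%:Z * v = 1 + (- u) * p%:Z by rewrite -uv; ring.
  have -> : b * (1 + - u * p%:Z) ^+ 2 = (b * (- u * 2 + u ^+ 2 * p%:Z)) * p%:Z + b.
    by ring.
  by rewrite modzMDl.
- by exists (y * m%:Z); rewrite exprMn -(modzMml (y ^+ 2)) yb modzMml.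
Qed.

Lemma kronecker_prime (b : int) (p : nat) : prime p -> p != 2%N ->
  kronecker b p = legendre b p.
Proof.
move=> pp p2; rewrite /kronecker primes_prime // big_seq1 (negbTE p2).
by rewrite logn_prime // eqxx expr1.
Qed.

Lemma kronecker_dvd (b : int) (p : nat) : prime p -> p != 2%N ->
  (p%:Z %| b)%Z -> kronecker b p = 0.
Proof. by move=> pp p2 pb; rewrite kronecker_prime // /legendre pb. Qed.

Lemma squarefree_ndvd_sqr t p m : squarefree t -> prime p ->
  ~~ (p %| m)%N -> ~~ (p ^ 2 %| t * m ^ 2)%N.
Proof.
move=> ht pp pm; rewrite Gauss_dvdl; last first.
  by rewrite coprimeXl // coprimeXr // prime_coprime.
by apply/negP => /ht p1; move: pp; rewrite p1.
Qed.

(** For n = t m^2 with m prime to p, the quadratic symbol of n at p does not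
depend on m, and p^2 does not divide n because t is squarefree. For
n = t (p m)^2 the symbol vanishes and n / p^2 = t m^2. In both cases the
coefficients of the recursion are independent of m. *)
Lemma hecke_square_recursion (R : realType) (k N t : nat) (chi : int -> R[i])
    (a : nat -> R[i]) (p : nat) :
  hecke_eigenform k N chi a -> squarefree t -> (0 < t)%N ->
  prime p -> p != 2%N -> ~~ (p %| N)%N ->
  exists A B D : R[i],
    (forall m, (0 < m)%N -> ~~ (p %| m)%N ->
       a (t * (p * m) ^ 2)%N = A * a (t * m ^ 2)%N) /\
    (forall m, (0 < m)%N ->
       a (t * (p * (p * m)) ^ 2)%N =
         B * a (t * (p * m) ^ 2)%N - D * a (t * m ^ 2)%N).
Proof.
move=> heig ht t0 pp p2 pN; have [l hl] := heig p pp pN.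
have p0 := prime_gt0 pp.
exists (l - chi p%:Z * (kronecker ((-1) ^+ k * t%:Z) p)%:~R * p%:R ^+ k.-1).
exists l, (chi (p%:Z ^+ 2) * p%:R ^+ k.*2.-1); split=> m m0.
- move=> pm; have := hl (t * m ^ 2)%N; rewrite muln_gt0 t0 expn_gt0 m0 => /(_ isT).
  rewrite /hecke_coef (negbTE (squarefree_ndvd_sqr ht pp pm)) mulr0 addr0.
  have -> : ((-1) ^+ k * (t * m ^ 2)%N%:Z) = ((-1) ^+ k * t%:Z) * m%:Z ^+ 2.
    by rewrite PoszM -mulrA; congr (_ * (_ * _)).
  rewrite !(kronecker_prime _ pp p2) legendre_mul_sqr // mulrBl => <-.
  by rewrite addrK expnMn mulnCA.
- have := hl (t * (p * m) ^ 2)%N; rewrite muln_gt0 t0 expn_gt0 muln_gt0 p0 m0 => /(_ isT).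
  have d2 : (t * (p * m) ^ 2 = p ^ 2 * (t * m ^ 2))%N by rewrite expnMn mulnCA.
  rewrite /hecke_coef kronecker_dvd //; last first.
    by apply: dvdz_mull; rewrite d2 expnS -mulnA; exact: (dvdn_mulr _ (dvdnn p)).
  rewrite mulr0 mul0r mul0r addr0 {2 3}d2 dvdn_mulr // mulKn ?expn_gt0 ?p0 //.
  by move=> <-; rewrite addrK; congr a; rewrite (expnMn p (p * m)) mulnCA.
Qed.

(** Both sides satisfy the same second order linear recursion in j with the same
initial values at j = 0 and j = 1. *)
Lemma eigenform_square_multiplicative (R : realType) (k N t : nat)
    (chi : int -> R[i]) (a : nat -> R) (p j m : nat) :
  hecke_eigenform k N chi (fun n => (a n)%:C) -> squarefree t -> (0 < t)%N ->
  prime p -> p != 2%N -> ~~ (p %| N)%N -> (0 < m)%N -> ~~ (p %| m)%N ->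
  a (t * (p ^ j * m) ^ 2)%N * a t = a (t * (p ^ j) ^ 2)%N * a (t * m ^ 2)%N.
Proof.
move=> heig ht t0 pp p2 pN m0 pm.
have [A [B [D [h1 h2]]]] := hecke_square_recursion heig ht t0 pp p2 pN.
have p0 := prime_gt0 pp.
apply: (@complexI R); rewrite !rmorphM /=.
suff [] : (a (t * (p ^ j * m) ^ 2)%N)%:C * (a t)%:C =
    (a (t * (p ^ j) ^ 2)%N)%:C * (a (t * m ^ 2)%N)%:C /\
    (a (t * (p ^ j.+1 * m) ^ 2)%N)%:C * (a t)%:C =
    (a (t * (p ^ j.+1) ^ 2)%N)%:C * (a (t * m ^ 2)%N)%:C by [].
have p1 : ~~ (p %| 1)%N by rewrite dvdn1; case: eqP pp => [->|].
elim: j => [|j [IH0 IH1]].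
  rewrite expn0 mul1n exp1n muln1 mulrC; split=> //.
  rewrite expn1 h1 // -[in RHS](muln1 p) (h1 1%N) // exp1n muln1; ring.
split=> //.
have e i : (p ^ i.+2 = p * (p * p ^ i))%N by rewrite !expnS.
have pj : (0 < p ^ j)%N by rewrite expn_gt0 p0.
rewrite e -!mulnA h2 ?muln_gt0 ?pj // (h2 _ pj) !mulrBl -!mulrA.
by move: IH0 IH1; rewrite !expnS -!mulnA => -> ->; ring.
Qed.

(** * The Shimura lift at primes and counting functions *)

Lemma big_divisors_prime (R : nzRingType) (F : nat -> R) p : prime p ->
  \sum_(d <- divisors p) F d = F 1%N + F p.
Proof.
move=> pp; have p1 : 1%N != p by case: eqP pp => [<-|].
have pe : perm_eq (divisors p) [:: 1%N; p].
  apply: uniq_perm; rewrite ?divisors_uniq //=; first by rewrite inE p1.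
  move=> d; rewrite -dvdn_divisors ?prime_gt0 // !inE.
  apply/idP/orP => [|[/eqP ->|/eqP ->]]; rewrite ?dvd1n ?dvdnn //.
  by move/primeP: pp => [_ h] /h /orP.
by rewrite (perm_big _ pe) /= big_cons big_seq1.
Qed.

Lemma quadratic_character_value (R : realType) N (chi : int -> R[i]) (m : int) :
  dirichlet_character N chi -> principal N (fun m => chi m ^+ 2) ->
  exists e : R, `|e| <= 1 /\ chi m = e%:C.
Proof.
move=> [_ _ _ hc] h2; have [cm|cm] := boolP (coprimez m N%:Z).
  have /eqP := h2 m cm; rewrite sqrf_eq1 => /orP[] /eqP ->.
    by exists 1; rewrite normr1.
  by exists (-1); rewrite normrN normr1 rmorphN1.
exists 0; rewrite normr0 ler01; split=> //.
by apply/eqP; have := hc m; rewrite (negbTE cm) => /negbFE.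
Qed.

Lemma kronecker_prime_norm (R : realType) (b : int) p : prime p ->
  exists e : R, `|e| <= 1 /\ (kronecker b p)%:~R = e%:C.
Proof.
move=> pp; rewrite /kronecker primes_prime // big_seq1 logn_prime // eqxx expr1 /legendre.
have h0 : exists e : R, `|e| <= 1 /\ (0 : int)%:~R = e%:C.
  by exists 0; rewrite normr0 ler01.
have h1 : exists e : R, `|e| <= 1 /\ (1 : int)%:~R = e%:C.
  by exists 1; rewrite normr1.
have hN1 : exists e : R, `|e| <= 1 /\ (-1 : int)%:~R = e%:C.
  by exists (-1); rewrite normrN normr1 rmorphN1 rmorphN1.
by do 3? case: ifP.
Qed.

(** Only the divisors 1 and p contribute; the second one gives a(t) with a
coefficient of size p^(k-1), which the normalisation turns into
e / (2 sqrt p). *)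
Lemma shimura_coef_prime (R : realType) (k N t : nat) (chi : int -> R[i])
    (a : nat -> R) p : (2 <= k)%N ->
  dirichlet_character N chi -> principal N (fun m => chi m ^+ 2) ->
  0 < a t -> prime p ->
  exists e : R, `|e| <= 1 /\
    shimura_coef k N t chi (fun n => (a n)%:C) p
        / (2 * a t * p%:R `^ (k%:R - 2^-1))%:C =
      (a (t * p ^ 2)%N / (2 * a t * p%:R `^ (k%:R - 2^-1)) + e / (2 * Num.sqrt p%:R))%:C.
Proof.
move=> hk hchi h2 hat pp.
have [e1 [e1l e1E]] := quadratic_character_value p%:Z hchi h2.
have [e2 [e2l e2E]] := kronecker_prime_norm R ((-1) ^+ k * N%:Z ^+ 2 * t%:Z) pp.
have p0 : (0 : R) < p%:R by rewrite ltr0n prime_gt0.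
exists (e1 * e2); split; first by rewrite normrM mulr_ile1.
rewrite /shimura_coef big_divisors_prime // /chi_tN e1E e2E.
have -> : (1%:Z : int) = 1 by [].
have [-> _ _ _] := hchi.
have -> : kronecker ((-1) ^+ k * N%:Z ^+ 2 * t%:Z) 1 = 1 by rewrite /kronecker big_nil.
rewrite expr1n !mul1r exp1n divn1 mulnK ?expn_gt0 ?prime_gt0 //.
have -> : p%:R `^ (k%:R - 2^-1) = p%:R ^+ k.-1 * Num.sqrt p%:R :> R.
  have -> : k%:R - 2^-1 = k.-1%:R + 2^-1 :> R.
    by rewrite -{1}(ltn_predK hk) -natr1; lra.
  rewrite powRD; last by rewrite (gt_eqF p0) implybT.
  by rewrite powR_mulrn ?powR12_sqrt // ltW.
have s0 : 0 < Num.sqrt (p%:R : R) by rewrite sqrtr_gt0.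
have pk : 0 < (p%:R : R) ^+ k.-1 by rewrite exprn_gt0.
have -> : (p%:R : R[i]) ^+ k.-1 = ((p%:R : R) ^+ k.-1)%:C by rewrite rmorphXn /= rmorph_nat.
rewrite -!rmorphM -rmorphD -fmorph_div /=; congr (_%:C).
by field; rewrite !gt_eqF.
Qed.

Lemma prime_countE (R : realType) (P : pred nat) (m : nat) :
  (prime_count P (m%:R : R))%:R = \sum_(1 <= i < m.+1 | prime i) (P i)%:R :> R.
Proof.
rewrite /prime_count natrK natr_sum [RHS]big_mkcond /= [RHS]big_nat_cond.
rewrite -(big_mkord (fun i => prime i && P i) (fun=> 1 : R)) big_ltn_cond //= big_mkcond.
rewrite [RHS]big_mkcond /= big_nat [RHS]big_nat; apply: eq_bigr => i /= /andP[-> ->] /=.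
by case: (prime i) => //; case: (P i).
Qed.

Lemma sum_leq_le (R : realType) r n : \sum_(1 <= i < n.+1) (i <= r)%N%:R <= r%:R :> R.
Proof.
suff -> : \sum_(1 <= i < n.+1) (i <= r)%N%:R = (minn n r)%:R :> R by rewrite ler_nat geq_minr.
elim: n => [|n IH]; first by rewrite big_geq // min0n.
by rewrite big_nat_recr //= IH -natrD; congr (_%:R); lia.
Qed.

Lemma sum_small_squares (R : realType) (m : nat) :
  \sum_(1 <= i < m.+1) (i ^ 2 < m)%N%:R <= Num.sqrt m%:R :> R.
Proof.
have sq0 := sqrtr_ge0 (m%:R : R).
apply: le_trans (le_trans (sum_leq_le R (Num.truncn (Num.sqrt (m%:R : R))) m) _); last first.
  by rewrite truncn_le.
apply: ler_sum => i _; rewrite ler_nat; case: ltnP => // im.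
rewrite truncn_ge_nat // -(ger0_norm (ler0n R i)) -sqrtr_sqr ler_wsqrtr //.
by rewrite -natrX ler_nat ltnW.
Qed.

(** * Sign sums over primes *)

(** Primes p with p^2 < m are few and are estimated trivially. For the others
1 / (2 sqrt p) <= eta = m^(-1/4) / 2, so B p <= - 2 eta forces y p < 0, and
y p = 0 forces |B p| <= eta. An upper bound for the sign sum thus needs only a
lower bound for the number of p with B p in [-1, - 2 eta], an interval of
measure at least 1/2 - 2 eta. *)
Lemma prime_sign_sums_le (R : realType) (y B : nat -> R) (C alpha beta : R) :
  0 < C -> 0 < alpha -> beta <= alpha -> beta <= 1 / 4 ->
  (forall p, prime p -> `|B p - y p| <= (2 * Num.sqrt p%:R)^-1) ->
  (forall (u v : R) m, -1 <= u -> u <= v -> v <= 1 -> (2 <= m)%N ->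
     `| (\sum_(1 <= i < m.+1 | prime i) (u <= B i <= v)%R%:R)
          / (\sum_(1 <= i < m.+1 | prime i) 1) - sato_tate `[u, v] |
       <= C / m%:R `^ alpha) ->
  forall m, (0 < m)%N ->
    \sum_(1 <= i < m.+1 | prime i) Num.sg (y i) <= (4 + 2 * C) * m%:R `^ (1 - beta) /\
    \sum_(1 <= i < m.+1 | prime i) (y i == 0)%R%:R <= (4 + 2 * C) * m%:R `^ (1 - beta).
Proof.
move=> C0 a0 ba b4 By hr m m0.
have K0 : 0 <= 4 + 2 * C by lra.
have [m1|m2] := leqP m 1.
  have -> : m = 1%N by apply/eqP; rewrite eqn_leq m1.
  by split; rewrite big_mkcond big_nat1 /= mulr_ge0 ?powR_ge0.
set M : R := m%:R; have M1 : 1 <= M by rewrite /M ler1n.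
have M0 : 0 < M by lra.
pose eta : R := (2 * M `^ (1 / 4))^-1.
have q0 : 0 < M `^ (1 / 4) by exact: powR_gt0.
have e0 : 0 < eta by rewrite invr_gt0 mulr_gt0.
have q1 : 1 <= M `^ (1 / 4) by rewrite powR_ge1 //; lra.
have e2 : 2 * eta = (M `^ (1 / 4))^-1 by rewrite /eta; field; rewrite gt_eqF.
have e1 : 2 * eta <= 1 by rewrite e2 invf_le1.
set pi_m := \sum_(1 <= i < m.+1 | prime i) (1 : R) in hr *.
have pi_pos : 0 < pi_m.
  rewrite /pi_m big_mkcond big_ltn // big_ltn //=.
  by apply: ltr_wpDl => //; apply: ltr_wpDr => //; apply: sumr_ge0 => i _; case: ifP.
have pi_le : pi_m <= M.
  rewrite /pi_m big_mkcond; apply: (@le_trans _ _ (\sum_(1 <= i < m.+1) 1)).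
    by apply: ler_sum => i _; case: ifP.
  by rewrite sumr_const_nat subSS subn0.
(* The error terms are all at most a multiple of the target power. *)
have MB r : M / M `^ r = M `^ (1 - r).
  by rewrite powRB ?(gt_eqF M0) ?implybT // powRr1 ?(ltW M0).
have P1 : M * (2 * eta) <= M `^ (1 - beta).
  by rewrite e2 MB; apply: ler_powR => //; lra.
have P2 : M * (C / M `^ alpha) <= C * M `^ (1 - beta).
  by rewrite mulrCA ler_pM2l // MB; apply: ler_powR => //; lra.
have P3 : Num.sqrt M <= M `^ (1 - beta).
  rewrite -powR12_sqrt ?(ltW M0) //; apply: ler_powR => //; lra.
have Pc : 0 <= C / M `^ alpha by rewrite mulr_ge0 ?invpowR_ge0 // ltW.
have small := @sum_small_squares R m.
have smallp : \sum_(1 <= i < m.+1 | prime i) (i ^ 2 < m)%N%:R <= Num.sqrt M.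
  by apply: le_trans small; rewrite big_mkcond; apply: ler_sum => i _; case: ifP.
have large p : prime p -> ~~ (p ^ 2 < m)%N -> `|B p - y p| <= eta.
  move=> pp; rewrite -leqNgt => mp; apply: le_trans (By p pp) _.
  have p0 : (0 : R) < p%:R by rewrite ltr0n prime_gt0.
  rewrite lef_pV2 ?posrE ?mulr_gt0 ?sqrtr_gt0 // ler_pM2l //.
  have -> : Num.sqrt (p%:R : R) = ((p ^ 2)%:R) `^ (1 / 4).
    rewrite natrX -powR_mulrn ?(ltW p0) // -powRrM -powR12_sqrt ?(ltW p0) //.
    by congr (_ `^ _); lra.
  by apply: ge0_ler_powR; rewrite ?nnegrE ?ler0n ?ler_nat //; lra.
have N1e : -1 <= - (2 * eta) by lra.
split.
- have := hr (-1) (- (2 * eta)) m (lexx _) N1e (_ : - (2 * eta) <= 1) m2.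
  have -> : - (2 * eta) <= 1 by lra.
  move=> /(_ isT); set E := \sum_(_ <= _ < _ | _) _.
  have := @sato_tate_left_ge R (2 * eta) _ e1.
  rewrite mulr_ge0 ?(ltW e0) // => /(_ isT) st.
  rewrite ler_distl => /andP[lo _].
  have Elo : pi_m * (1 / 2 - 2 * eta - C / M `^ alpha) <= E.
    by rewrite mulrC -ler_pdivlMr //; lra.
  have : \sum_(1 <= i < m.+1 | prime i) Num.sg (y i) <=
     \sum_(1 <= i < m.+1 | prime i)
        (1 - 2 * (-1 <= B i <= - (2 * eta))%R%:R + 2 * (i ^ 2 < m)%N%:R).
    apply: ler_sum => p pp.
    have sg1 : Num.sg (y p) <= 1 by case: sgrP => //; lra.
    case sm : (p ^ 2 < m)%N; first by case: (_ <= B p <= _) => /=; lra.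
    case bb : (-1 <= B p <= _) => /=; last lra.
    have yl : `|B p - y p| <= eta by apply: large; rewrite ?sm.
    move/andP: bb => [_ bb].
    move: yl; rewrite ler_distl => /andP[yl1 yl2].
    have -> : Num.sg (y p) = -1 by apply: ltr0_sg; lra.
    lra.
  rewrite !big_split /= -/pi_m sumrN -!mulr_sumr -/E => h.
  have h2 : pi_m * (4 * eta + 2 * (C / M `^ alpha)) <= M * (4 * eta + 2 * (C / M `^ alpha)).
    by rewrite ler_wpM2r //; lra.
  lra.
- have N1e' : -1 <= - eta by lra.
  have e1' : eta <= 1 by lra.
  have Nee : - eta <= eta by lra.
  have := hr (- eta) eta m N1e' Nee e1' m2.
  set E := \sum_(_ <= _ < _ | _) _.
  have st := @sato_tate_itv_le R (- eta) eta N1e' Nee e1'.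
  rewrite ler_distl => /andP[_ hi].
  have Ehi : E <= pi_m * (2 * eta + C / M `^ alpha).
    by rewrite mulrC -ler_pdivrMr //; lra.
  have : \sum_(1 <= i < m.+1 | prime i) (y i == 0)%R%:R <=
     \sum_(1 <= i < m.+1 | prime i)
        ((- eta <= B i <= eta)%R%:R + (i ^ 2 < m)%N%:R) :> R.
    apply: ler_sum => p pp; case: eqP => [y0|_]; last by rewrite addr_ge0 ?ler0n.
    case sm : (p ^ 2 < m)%N; first by rewrite lerDr ler0n.
    have := @large p pp; rewrite sm y0 subr0 => /(_ isT).
    by rewrite ler_norml => ->; rewrite addr0.
  rewrite big_split /= -/E => h.
  have h2 : pi_m * (2 * eta + C / M `^ alpha) <= M * (2 * eta + C / M `^ alpha).
    by rewrite ler_wpM2r //; lra.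
  have X0 : 0 <= M `^ (1 - beta) by exact: powR_ge0.
  have CX : 0 <= C * M `^ (1 - beta) by rewrite mulr_ge0 // ltW.
  lra.
Qed.

(** * Boundedness of the Dirichlet series of signs *)

(** Since q <= 1/3, the truncated Euler factor is positive, so that
1 + x <= exp x bounds its absolute value; the terms from q^2 on contribute at
most q^2 / (1 - q) <= 3/2 q^2. *)
Lemma local_factor_le (R : realType) (q : R) (g : nat -> R) J :
  0 <= q -> q <= 1 / 3 -> g 0%N = 1 -> (forall j, `|g j| <= 1) -> (2 <= J)%N ->
  `|\sum_(j < J) q ^+ j * g j| <= expR (g 1%N * q + 2 * q ^+ 2).
Proof.
move=> q0 q3 g0 g1 J2.
have rest : `|\sum_(j < J) q ^+ j * g j - (1 + q * g 1%N)| <= 3 / 2 * (q ^+ 2 - q ^+ J).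
  elim: J J2 => [//|[//|[|J]] IH] _.
    by rewrite big_ord_recr big_ord1 /= expr0 expr1 g0 mulr1 !subrr normr0 mulr0.
  rewrite big_ord_recr /= addrAC; apply: le_trans (ler_normD _ _) _.
  have := IH isT; have qJ : 0 <= q ^+ J.+2 by exact: exprn_ge0.
  have : `|q ^+ J.+2 * g J.+2| <= q ^+ J.+2.
    by rewrite normrM (ger0_norm qJ) ler_piMr.
  have : q ^+ J.+3 <= 1 / 3 * q ^+ J.+2 by rewrite exprS ler_wpM2r.
  by lra.
have qJ : 0 <= q ^+ J by exact: exprn_ge0.
have q2 : q ^+ 2 <= 1 / 3 * q by rewrite expr2 ler_wpM2r.
have q2' : 0 <= q ^+ 2 by exact: exprn_ge0.
have /andP[g1l g1u] : -1 <= g 1%N <= 1 by rewrite -ler_norml.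
have gl : - q <= q * g 1%N by rewrite -mulrN1 ler_wpM2l.
apply: le_trans (expR_ge1Dx _).
move: rest; rewrite ler_distl => /andP[r1 r2].
by rewrite ger0_norm; lra.
Qed.

Lemma invpowR_prime_le (R : realType) (z : R) p : 1 <= z -> (1 < p)%N ->
  ((p%:R : R) `^ z)^-1 <= p%:R^-1.
Proof.
move=> z1 p1; have p0 : (0 : R) < p%:R by rewrite ltr0n ltnW.
rewrite lef_pV2 ?posrE ?powR_gt0 // -[leLHS]powRr1 ?(ltW p0) //.
by apply: ler_powR; rewrite ?ler1n // ltnW.
Qed.

(** Multiplicativity of F at the single prime p, with the local factors of s. It
is weaker than multiplicativity and stable under the substitutions
n |-> n q^j for q <> p, which is what the removal of the primes dividing N
needs. *)
Definition factors_at (R : realType) (s : nat -> R) (p : nat) (F : nat -> R) :=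
  forall j m, (0 < m)%N -> ~~ (p %| m)%N -> F (m * p ^ j)%N = s (p ^ j)%N * F m.

Lemma dseries_peel_prime_le (R : realType) (s F : nat -> R) (z : R) p :
  1 < z -> (2 < p)%N -> s 1%N = 1 -> (forall n, `|s n| <= 1) ->
  (forall n, `|F n| <= 1) -> factors_at s p F ->
  `|dseries F z| <=
     expR (s p * (p%:R `^ z)^-1 + 2 * (p%:R `^ 2)^-1)
       * `|dseries (fun n => if (p %| n)%N then 0 else F n) z|.
Proof.
move=> z1 p2 s1 sb Fb hF; set q := (p%:R `^ z)^-1.
have p0 : (0 : R) < p%:R by rewrite ltr0n (ltn_trans _ p2).
have q0 : 0 <= q by exact: invpowR_ge0.
have qp : q <= p%:R^-1 by apply: invpowR_prime_le; rewrite ?ltW // (ltn_trans _ p2).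
have q3 : q <= 1 / 3.
  by apply: le_trans qp _; rewrite div1r lef_pV2 ?posrE // ler_nat.
have q1 : q < 1 by lra.
apply: (@le_of_geometric_error _ _ _ (z / (z - 1)) q); first by rewrite q0.
move=> J J2; rewrite (@dseries_peel_iter _ F z 1 p J) ?(ltn_trans _ p2) //.
apply: le_trans (ler_normD _ _) _; apply: lerD; last first.
  rewrite normrM ger0_norm ?exprn_ge0 // ler_wpM2l ?exprn_ge0 //.
  by have := @ler_norm_dseries R _ z 1 z1 (fun k => Fb (k * p ^ J)%N); rewrite mul1r.
set G := fun n => if (p %| n)%N then 0 else F n.
have Gb n : `|G n| <= 1 by rewrite /G; case: ifP => // _; rewrite normr0.
have -> : \sum_(j < J) q ^+ j *
    dseries (fun n => if (p %| n)%N then 0 else F (n * p ^ j)%N) z =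
    (\sum_(j < J) q ^+ j * s (p ^ j)%N) * dseries G z.
  rewrite mulr_suml; apply: eq_bigr => j _; rewrite -mulrA; congr (_ * _).
  rewrite -(dseriesZ _ z1 Gb); apply: eq_dseries => n n0.
  by rewrite /G; case: ifPn => [_|pn]; rewrite ?mulr0 // hF.
rewrite normrM ler_wpM2r //.
apply: le_trans (@local_factor_le R q (fun j => s (p ^ j)%N) J q0 q3 s1 _ J2) _ => //.
rewrite ler_expR expn1 lerD2l ler_pM2l //.
apply: le_trans (_ : p%:R^-1 ^+ 2 <= _).
  by rewrite lerXn2r ?nnegrE ?invr_ge0 ?(ltW p0).
by rewrite exprVn powR_mulrn // ltW.
Qed.

(** Coefficients after removal of the Euler factors at the primes p < P not
dividing N. *)
Definition sieve (R : realType) (N P : nat) (F : nat -> R) (n : nat) : R :=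
  if has (fun p => [&& prime p, ~~ (p %| N)%N & (p %| n)%N]) (iota 0 P) then 0
  else F n.

Lemma sieve_le1 (R : realType) N P (F : nat -> R) :
  (forall n, `|F n| <= 1) -> forall n, `|sieve N P F n| <= 1.
Proof. by move=> Fb n; rewrite /sieve; case: ifP => //; rewrite normr0. Qed.

(** Induction on P: the Euler factor at P is peeled off when P is a prime not
dividing N. Such a P is odd, hence at least 3, as N is even. *)
Lemma dseries_sieve_le (R : realType) (s F : nat -> R) (z : R) N P :
  1 < z -> (2 %| N)%N -> s 1%N = 1 -> (forall n, `|s n| <= 1) ->
  (forall n, `|F n| <= 1) ->
  (forall p, prime p -> ~~ (p %| N)%N -> factors_at s p F) ->
  `|dseries F z| <=
    expR (\sum_(0 <= p < P | prime p && ~~ (p %| N)%N)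
            (s p * (p%:R `^ z)^-1 + 2 * (p%:R `^ 2)^-1))
      * `|dseries (sieve N P F) z|.
Proof.
move=> z1 N2 s1 sb Fb hF; elim: P => [|P IH].
  by rewrite big_geq // expR0 mul1r.
apply: (le_trans IH); rewrite [in leRHS]big_mkcond big_nat_recr //= -big_mkcond.
have sE n : sieve N P.+1 F n =
    if [&& prime P, ~~ (P %| N)%N & (P %| n)%N] then 0 else sieve N P F n.
  rewrite /sieve -addn1 iotaD has_cat /= orbF add0n.
  by case: (has _ _); case: [&& _, _ & _].
case: ifP => [/andP[pP PN]|nP]; last first.
  rewrite addr0.
  rewrite (@eq_dseries _ (sieve N P.+1 F) (sieve N P F)) // => n _.
  by rewrite sE andbA nP.
rewrite expRD -mulrA ler_wpM2l ?expR_ge0 //.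
have P2 : (2 < P)%N.
  rewrite ltn_neqAle prime_gt1 // andbT.
  by apply: contra PN => /eqP <-.
have hs : factors_at s P (sieve N P F).
  move=> j m m0 Pm; rewrite /sieve.
  have -> : has (fun p => [&& prime p, ~~ (p %| N)%N & (p %| m * P ^ j)%N]) (iota 0 P) =
            has (fun p => [&& prime p, ~~ (p %| N)%N & (p %| m)%N]) (iota 0 P).
    apply: eq_in_has => p; rewrite mem_iota add0n => /andP[_ pP'].
    case pp : (prime p) => //=; congr (_ && _).
    rewrite Euclid_dvdM // [(p %| P ^ j)%N]Euclid_dvdX // (dvdn_prime2 pp pP).
    by rewrite (ltn_eqF pP') /= orbF.
  by case: ifP => _; rewrite ?mulr0 // hF.
apply: le_trans (dseries_peel_prime_le z1 P2 s1 sb (sieve_le1 N P Fb) hs) _.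
rewrite ler_wpM2l ?expR_ge0 // le_eqVlt; apply/orP; left; apply/eqP.
by congr (`| _ |); apply: eq_dseries => n _; rewrite sE pP PN.
Qed.

(** On n prime to N, only n = 1 and n >= P survive the sieve. With
e = (z - 1) / 2, an n >= P satisfies 1 <= (n / P)^e, which leaves a factor
P^(-e) in front of a convergent series. *)
Lemma dseries_sieve_tail (R : realType) (F : nat -> R) (z : R) N P :
  1 < z -> (0 < P)%N -> (forall n, `|F n| <= 1) ->
  (forall n, (0 < n)%N -> F n != 0 -> coprime n N) ->
  `|dseries (sieve N P F) z| <= 1 +
     (P%:R `^ ((z - 1) / 2))^-1 * ((1 + (z - 1) / 2) / ((z - 1) / 2)).
Proof.
move=> z1 P0 Fb hN; set e := (z - 1) / 2.
have e0 : 0 < e by rewrite /e; lra.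
have h m : `|dsum (sieve N P F) z m| <= 1 + (P%:R `^ e)^-1 * ((1 + e) / e).
  apply: (@le_trans _ _ (dsum (fun n => (n == 1%N)%:R +
      (P%:R `^ e)^-1 * n%:R `^ e) z m)).
    apply: ler_norm_dsum => n n0.
    have [->|n1] := eqVneq n 1%N.
      apply: le_trans (sieve_le1 _ _ Fb _) _.
      by rewrite lerDl mulr_ge0 ?invpowR_ge0 ?powR_ge0.
    rewrite add0r /sieve; case: ifP => [_|/negbT hn].
      by rewrite normr0 mulr_ge0 ?invpowR_ge0 ?powR_ge0.
    have [->|Fn] := eqVneq (F n) 0.
      by rewrite normr0 mulr_ge0 ?invpowR_ge0 ?powR_ge0.
    apply: le_trans (Fb n) _; rewrite mulrC ler_pdivlMr ?powR_gt0 ?ltr0n // mul1r.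
    apply: ge0_ler_powR; rewrite ?nnegrE ?ler0n ?ler_nat ?(ltW e0) //.
    rewrite leqNgt; apply: contra hn => nP; apply/hasP.
    have n2 : (1 < n)%N by rewrite ltn_neqAle eq_sym n1.
    exists (pdiv n); first by rewrite mem_iota /= add0n (leq_ltn_trans (pdiv_leq n0)).
    rewrite pdiv_prime // pdiv_dvd andbT /=.
    have := coprime_dvdl (pdiv_dvd n) (hN n n0 Fn).
    by rewrite prime_coprime // pdiv_prime.
  rewrite dsumD dsumZ; apply: lerD.
    rewrite /dsum; case: (ltnP 1 m) => m1; last by rewrite big_geq.
    rewrite big_ltn // eqxx mul1r powR1 invr1 big_nat big1 ?addr0 // => n /andP[n1 _].
    by rewrite gtn_eqF // mul0r.
  rewrite ler_wpM2l ?invpowR_ge0 // ler_pdivlMr //.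
  have e1 : 1 < 1 + e by lra.
  have := @dsum1_le R (1 + e) m e1; rewrite [1 + e - 1]addrC addKr mulrC.
  apply: le_trans; rewrite ler_wpM2r ?(ltW e0) //.
  rewrite /dsum big_nat [leRHS]big_nat; apply: ler_sum => n /andP[n0 _].
  rewrite mul1r -!powRN -powRD; last by rewrite pnatr_eq0 -lt0n n0 implybT.
  by apply: ler_powR; rewrite ?ler1n // /e; lra.
have Sb := sieve_le1 N P Fb.
rewrite ler_norml; apply/andP; split.
  by apply: (dseries_ge z1 Sb) => m _; have := h m; rewrite ler_norml => /andP[].
by apply: (dseries_le z1 Sb) => m; have := h m; rewrite ler_norml => /andP[].
Qed.

(** Let P tend to infinity in the previous two bounds. *)
Lemma dseries_coprime_bounded (R : realType) (s F : nat -> R) (z K : R) N :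
  1 < z -> (2 %| N)%N -> s 1%N = 1 -> (forall n, `|s n| <= 1) ->
  (forall n, `|F n| <= 1) ->
  (forall p, prime p -> ~~ (p %| N)%N -> factors_at s p F) ->
  (forall n, (0 < n)%N -> F n != 0 -> coprime n N) ->
  (forall P, \sum_(0 <= p < P | prime p && ~~ (p %| N)%N)
            (s p * (p%:R `^ z)^-1 + 2 * (p%:R `^ 2)^-1) <= K) ->
  `|dseries F z| <= expR K.
Proof.
move=> z1 N2 s1 sb Fb hF hN hK.
set e := (z - 1) / 2; have e0 : 0 < e by rewrite /e; lra.
set B := (1 + e) / e.
have h P : (0 < P)%N -> `|dseries F z| <= expR K * (1 + (P%:R `^ e)^-1 * B).
  move=> P0; apply: le_trans (dseries_sieve_le P z1 N2 s1 sb Fb hF) _.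
  rewrite ler_pM ?expR_ge0 ?ler_expR //.
  exact: dseries_sieve_tail.
have cv : expR K * (1 + (P%:R `^ e)^-1 * B) @[P --> \oo] --> expR K.
  rewrite -[X in _ --> X]mulr1; apply: cvgMl_tmp.
  rewrite -[X in _ --> X]addr0 -(mul0r B); apply: cvgD; first exact: cvg_cst.
  by apply: cvgMr_tmp; exact: invpowR_cvg0.
rewrite -(cvg_lim _ cv) //; apply: limr_ge; first by apply/cvg_ex; eexists; exact: cv.
by near=> P; apply: h; near: P; exists 1%N.
Unshelve. all: by end_near. Qed.

(** Induction on the list l of primes dividing N that may divide the support of
F. Peeling q writes the series as the sum over j of q^(-jz) times series of the
same kind for the shorter list, and the sum of q^(-jz) is at most 2. *)
Lemma dseries_factoring_bounded (R : realType) (s : nat -> R) (z K : R) N (l : seq nat) :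
  1 < z -> (2 %| N)%N -> s 1%N = 1 -> (forall n, `|s n| <= 1) ->
  (forall P, \sum_(0 <= p < P | prime p && ~~ (p %| N)%N)
            (s p * (p%:R `^ z)^-1 + 2 * (p%:R `^ 2)^-1) <= K) ->
  (forall q, q \in l -> prime q && (q %| N)%N) ->
  forall F : nat -> R, (forall n, `|F n| <= 1) ->
  (forall p, prime p -> ~~ (p %| N)%N -> factors_at s p F) ->
  (forall n q, (0 < n)%N -> F n != 0 -> prime q -> (q %| N)%N -> (q %| n)%N -> q \in l) ->
  `|dseries F z| <= 2 ^+ size l * expR K.
Proof.
move=> z1 N2 s1 sb hK; elim: l => [|q l IH] hl F Fb hF hs.
  rewrite expr0 mul1r; apply: (dseries_coprime_bounded z1 N2 s1 sb) => // n n0 Fn.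
  apply/negP => /negP g1.
  have g2 : (1 < gcdn n N)%N.
    by rewrite ltn_neqAle eq_sym g1 gcdn_gt0 n0.
  have := hs n (pdiv (gcdn n N)) n0 Fn (pdiv_prime g2).
  by rewrite !(dvdn_trans (pdiv_dvd _)) ?dvdn_gcdl ?dvdn_gcdr // => /(_ isT isT).
have /andP[pq qN] := hl q (mem_head _ _).
have q2 : (2 : R) <= q%:R by rewrite ler_nat prime_gt1.
set x := (q%:R `^ z)^-1.
have x0 : 0 <= x by exact: invpowR_ge0.
have x2 : x <= 1 / 2.
  apply: le_trans (invpowR_prime_le (ltW z1) (prime_gt1 pq)) _.
  by rewrite div1r lef_pV2 ?posrE //; lra.
set B := 2 ^+ size l * expR K.
have B0 : 0 <= B by rewrite mulr_ge0 ?expR_ge0 ?exprn_ge0.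
apply: (@le_of_geometric_error _ _ _ (z / (z - 1)) x); first by rewrite x0; lra.
move=> J J2; rewrite (@dseries_peel_iter _ F z 1 q J) ?prime_gt0 //.
apply: le_trans (ler_normD _ _) _; apply: lerD; last first.
  rewrite normrM ger0_norm ?exprn_ge0 // ler_wpM2l ?exprn_ge0 //.
  by have := @ler_norm_dseries R _ z 1 z1 (fun k => Fb (k * q ^ J)%N); rewrite mul1r.
have geo : \sum_(j < J) x ^+ j <= 2.
  have : (1 - x) * (\sum_(j < J) x ^+ j) <= 1.
    by rewrite -opprB mulNr -subrX1 opprB gerBl exprn_ge0.
  by nra.
rewrite /= exprS -mulrA -/B.
apply: le_trans (_ : \sum_(j < J) x ^+ j * B <= _); last first.
  by rewrite -mulr_suml ler_wpM2r.
apply: le_trans (ler_norm_sum _ _ _) _; apply: ler_sum => j _.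
rewrite normrM ger0_norm ?exprn_ge0 // ler_wpM2l ?exprn_ge0 //.
apply: IH.
- by move=> r rl; apply: hl; rewrite inE rl orbT.
- by move=> n; case: ifP => //; rewrite normr0.
- move=> p pp pN i m m0 pm.
  have pq' : p != q by apply: contra pN => /eqP ->.
  have -> : (q %| m * p ^ i)%N = (q %| m)%N.
    rewrite Euclid_dvdM // [(q %| p ^ i)%N]Euclid_dvdX // (dvdn_prime2 pq pp) eq_sym.
    by rewrite (negbTE pq') orbF.
  case: ifP => _; first by rewrite mulr0.
  rewrite mulnAC hF // ?muln_gt0 ?m0 ?expn_gt0 ?prime_gt0 //.
  by rewrite Euclid_dvdM // negb_or pm /= Euclid_dvdX // (dvdn_prime2 pp pq) (negbTE pq').
- move=> n r n0; case: ifPn => [_|qn Fn pr rN rn]; first by rewrite eqxx.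
  have := hs (n * q ^ j)%N r; rewrite muln_gt0 n0 expn_gt0 prime_gt0 // => /(_ isT Fn pr rN).
  rewrite dvdn_mulr // inE => /(_ isT) /orP[/eqP rq|//].
  by move: qn; rewrite -rq rn.
Qed.

(** * Almost periodicity of the non-vanishing set *)

Lemma summable_tail_le (R : realType) (w : nat -> R) (K : R) :
  (forall i, 0 <= w i) -> (forall m, \sum_(1 <= i < m) w i <= K) ->
  forall e, 0 < e -> exists P0, forall P m, (P0 <= P)%N ->
    \sum_(P <= i < m) w i <= e.
Proof.
move=> w0 wK e e0; pose u m := \sum_(1 <= i < m) w i.
have u_nd : nondecreasing_seq u.
  apply/nondecreasing_seqP => -[|n]; rewrite /u; first by rewrite !big_geq.
  by rewrite [leRHS]big_nat_recr //= lerDl.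
have u_cv : cvgn u.
  by apply: nondecreasing_is_cvgn => //; exists K => _ [m _ <-]; exact: wK.
have [P0 _ hP] : \forall P \near \oo, limn u - e <= u P.
  have /cvgrPdist_le /(_ e e0) := u_cv; apply: filterS => P.
  by rewrite ler_distl -lerBlDr => /andP[].
exists P0.+1 => P m P0P; have [mP|Pm] := leqP m P; first by rewrite big_geq ?ltW.
have P1 : (1 <= P)%N by apply: leq_trans P0P.
have : u m = u P + \sum_(P <= i < m) w i by rewrite /u -big_cat_nat // ltnW.
have := nondecreasing_cvgn_le u_nd u_cv m.
have := hP P (ltnW P0P) => /=; lra.
Qed.

Lemma nonvanishing_mul_squarefree (nz : nat -> bool) (N : nat) :
  (forall p m, prime p -> ~~ (p %| N)%N -> (0 < m)%N -> ~~ (p %| m)%N ->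
     nz (m * p)%N = nz p && nz m) ->
  forall b g, (0 < b)%N -> (0 < g)%N ->
  (forall p, prime p -> (p %| b)%N ->
     [/\ ~~ (p %| N)%N, ~~ (p %| g)%N, nz p & ~~ (p ^ 2 %| b)%N]) ->
  nz (b * g)%N = nz g.
Proof.
move=> hm; elim/ltn_ind => b IH g b0 g0 hb.
have [b1|b1] := leqP b 1.
  by have -> : b = 1%N by [apply/eqP; rewrite eqn_leq b1]; rewrite mul1n.
have pp := pdiv_prime b1; have pb := pdiv_dvd b; set p := pdiv b in pp pb.
have [pN pg np p2] := hb p pp pb.
have bE : (b %/ p * p)%N = b by exact: divnK.
have b'0 : (0 < b %/ p)%N by rewrite divn_gt0 ?prime_gt0 // dvdn_leq.
have pb' : ~~ (p %| b %/ p)%N.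
  by apply: contra p2 => h; rewrite -bE expnS expn1 dvdn_mul.
rewrite -{1}bE mulnAC hm ?muln_gt0 ?b'0 //; last by rewrite Euclid_dvdM // negb_or pb'.
rewrite np /=; apply: IH => //; first by rewrite ltn_Pdiv // prime_gt1.
move=> r pr rb; have rb' : (r %| b)%N by rewrite -bE dvdn_mulr.
have [? ? ? r2] := hb r pr rb'; split=> //.
by apply: contra r2 => h; rewrite -bE dvdn_mulr.
Qed.

Lemma prime_dvd_fact p n : prime p -> (p %| n`!)%N = (p <= n)%N.
Proof.
move=> pp; apply/idP/idP => [|pn]; last by rewrite dvdn_fact // prime_gt0.
elim: n => [|n IH]; first by rewrite fact0 dvdn1; case: eqP pp => // ->.
by rewrite factS Euclid_dvdM // => /orP[/dvdn_leq -> //|/IH /leqW].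
Qed.

(** For n = b g with g the gcd, a prime p <= P cannot divide b: otherwise
p^(2P) would divide n, and e = p^P >= P would violate the assumption on squares.
So the primes dividing b exceed P, are prime to N and g, occur once, and do not
affect vanishing. *)
Lemma nonvanishing_gcd (nz : nat -> bool) (N P n : nat) :
  (forall p m, prime p -> ~~ (p %| N)%N -> (0 < m)%N -> ~~ (p %| m)%N ->
     nz (m * p)%N = nz p && nz m) ->
  (0 < N)%N -> (N <= P)%N -> (0 < n)%N ->
  (forall e, (P <= e)%N -> ~~ [&& prime e, ~~ nz e & (e %| n)%N]) ->
  (forall e, (P <= e)%N -> ~~ (e ^ 2 %| n)%N) ->
  nz n = nz (gcdn n (P`! ^ (2 * P))).
Proof.
move=> hm N0 NP n0 h1 h2; set Q := (P`! ^ (2 * P))%N; set g := gcdn n Q.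
have P0 : (0 < P)%N by exact: leq_trans NP.
have Q0 : (0 < Q)%N by rewrite expn_gt0 fact_gt0.
have g0 : (0 < g)%N by rewrite gcdn_gt0 n0.
have nE : (n %/ g * g)%N = n by rewrite divnK // dvdn_gcdl.
have b0 : (0 < n %/ g)%N by rewrite divn_gt0 // dvdn_leq // dvdn_gcdl.
rewrite -{1}nE; apply: (nonvanishing_mul_squarefree hm) => // p pp pb.
have pn : (p %| n)%N by rewrite -nE dvdn_mulr.
have Pp : (P < p)%N.
  rewrite ltnNge; apply/negP => pP.
  have lQ : (2 * P <= logn p Q)%N.
    rewrite /Q lognX leq_pmulr // logn_gt0 mem_primes pp fact_gt0.
    by rewrite prime_dvd_fact.
  have ln : (logn p n < 2 * P)%N.
    rewrite ltnNge -pfactor_dvdn // mulnC expnM h2 //.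
    by rewrite ltnW // ltn_expl // prime_gt1.
  have lg : logn p g = logn p n.
    by rewrite /g logn_gcd // (minn_idPl (leq_trans (ltnW ln) lQ)).
  have : logn p n = (logn p (n %/ g) + logn p g)%N by rewrite -lognM // nE.
  rewrite lg => /eqP; rewrite -{1}[logn p n]add0n eqn_add2r => /eqP lb.
  have : (0 < logn p (n %/ g))%N by rewrite logn_gt0 mem_primes pp b0.
  by rewrite -lb.
split.
- apply/negP => /(dvdn_leq N0) pN; have := leq_trans Pp (leq_trans pN NP).
  by rewrite ltnn.
- apply/negP => pg; have : (p %| Q)%N by apply: dvdn_trans pg (dvdn_gcdr _ _).
  by rewrite Euclid_dvdX // prime_dvd_fact // leqNgt Pp.
- by have := h1 p (ltnW Pp); rewrite pp pn andbT /= negbK.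
- apply: contra (h2 p (ltnW Pp)) => h; rewrite -nE; exact: dvdn_mulr.
Qed.

Lemma dsum_le_dseries (R : realType) (F : nat -> R) (z c : R) m : 1 < z ->
  (forall n, 0 <= F n) -> (forall n, `|F n| <= c) -> dsum F z m <= dseries F z.
Proof.
move=> z1 F0 Fc; have hc := dsum_cvg z1 Fc.
rewrite /dseries; apply: nondecreasing_cvgn_le; last by apply/cvg_ex; eexists; exact: hc.
apply/nondecreasing_seqP => -[|n]; rewrite /dsum; first by rewrite !big_geq.
by rewrite [leRHS]big_nat_recr //= lerDl mulr_ge0 ?invpowR_ge0.
Qed.

Lemma ler_dseries (R : realType) (F G : nat -> R) (z c d : R) : 1 < z ->
  (forall n, `|F n| <= c) -> (forall n, `|G n| <= d) ->
  (forall n, (0 < n)%N -> F n <= G n) -> dseries F z <= dseries G z.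
Proof.
move=> z1 Fc Gd FG; have hF := dsum_cvg z1 Fc; have hG := dsum_cvg z1 Gd.
rewrite /dseries; apply: ler_lim.
- by apply/cvg_ex; eexists; exact: hF.
- by apply/cvg_ex; eexists; exact: hG.
- by near=> m; exact: ler_dsum.
Unshelve. all: by end_near. Qed.

(** The number of ways in which e prevents reading off nz n from the gcd of n with
a highly divisible modulus: as a prime divisor at which nz fails, or through
divisibility by e^2. *)
Definition bad_divisor_count (R : realType) (nz : nat -> bool) (e n : nat) : R :=
  ([&& prime e, ~~ nz e & (e %| n)%N])%:R + (e ^ 2 %| n)%N%:R.

(** Multiples of d carry at most d^(-z) <= 1/d of the mass of H, because H does
not increase along multiplication by d; summing over the possible bad divisors
gives the tail of the convergent series. Both the constant 1 and the indicator
function of the integers prime to a modulus are admissible for H. *)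
Lemma dseries_bad_divisors_le (R : realType) (nz : nat -> bool) (z eps : R) P
    (H X : nat -> R) : 1 < z -> (0 < P)%N ->
  (forall n, 0 <= H n <= 1) -> (forall k d, H (k * d)%N <= H k) ->
  (forall n, `|X n| <= 1) ->
  (forall n, (0 < n)%N -> X n <= \sum_(P <= e < n.+1) bad_divisor_count R nz e n * H n) ->
  (forall m, \sum_(P <= e < m)
      ((prime e && ~~ nz e)%:R * (e%:R `^ 1)^-1 + (e%:R `^ 2)^-1) <= eps) ->
  dseries X z <= eps * dseries H z.
Proof.
move=> z1 P0 H01 Hd X1 hX heps.
have H0 n : 0 <= H n by have /andP[] := H01 n.
have H1 n : `|H n| <= 1 by rewrite ger0_norm //; have /andP[] := H01 n.
have DH0 : 0 <= dseries H z.
  apply: (dseries_ge z1 H1) => m _; apply: sumr_ge0 => n _.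
  by rewrite mulr_ge0 ?invpowR_ge0.
have mult d m : (0 < d)%N ->
    dsum (fun n => if (d %| n)%N then H n else 0) z m <= (d%:R `^ z)^-1 * dseries H z.
  move=> d0; have b n : `|if (d %| n)%N then H n else 0| <= 1.
    by case: ifP => // _; rewrite normr0.
  apply: (@le_trans _ _ (dseries (fun n => if (d %| n)%N then H n else 0) z)).
    by apply: (dsum_le_dseries _ z1 _ b) => n; case: ifP.
  rewrite (dseries_dvd z1 H1 d0) ler_wpM2l ?invpowR_ge0 //.
  by apply: (ler_dseries z1 _ H1) => // n; rewrite H1.
apply: (dseries_le z1 X1) => m.
apply: (@le_trans _ _ (\sum_(P <= e < m) \sum_(1 <= n < m)
    bad_divisor_count R nz e n * H n * (n%:R `^ z)^-1)).
  rewrite exchange_big_nat /=.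
  apply: ler_sum_nat => n /andP[n0 nm].
  rewrite -mulr_suml ler_wpM2r ?invpowR_ge0 //.
  apply: le_trans (hX n n0) _.
  have [Pn|nP] := leqP P n.+1.
    rewrite [leRHS](@big_cat_nat _ _ _ n.+1) //= lerDl.
    by apply: sumr_ge0 => e _; rewrite mulr_ge0 ?addr_ge0.
  rewrite big_geq ?(ltnW nP) //.
  by apply: sumr_ge0 => e _; rewrite mulr_ge0 ?addr_ge0.
apply: (@le_trans _ _ (\sum_(P <= e < m) ((prime e && ~~ nz e)%:R * (e%:R `^ 1)^-1
     + (e%:R `^ 2)^-1) * dseries H z)); last by rewrite -mulr_suml ler_wpM2r.
rewrite big_nat [leRHS]big_nat; apply: ler_sum => e /andP[Pe _].
have e0 : (0 < e)%N by exact: leq_trans Pe.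
have e1 : (1 : R) <= e%:R by rewrite ler1n.
have weight (d : nat) (r : R) : (0 < d)%N -> (d%:R : R) = e%:R `^ r -> 0 <= r ->
    (d%:R `^ z)^-1 * dseries H z <= (e%:R `^ r)^-1 * dseries H z.
  move=> d0 dE r0; rewrite ler_wpM2r // -dE lef_pV2 ?posrE ?powR_gt0 ?ltr0n //.
  by rewrite -[leLHS]powRr1 // ler_powR ?ler1n // ltW.
rewrite mulrDl; apply: (@le_trans _ _ (
   (prime e && ~~ nz e)%:R * dsum (fun n => if (e %| n)%N then H n else 0) z m
   + dsum (fun n => if (e ^ 2 %| n)%N then H n else 0) z m)).
  rewrite -dsumZ -dsumD /dsum; apply: ler_sum => n _.
  rewrite ler_wpM2r ?invpowR_ge0 // /bad_divisor_count mulrDl andbA.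
  rewrite -mulnb natrM -mulrA.
  by apply: lerD; [rewrite ler_wpM2l //|]; case: ifP => _; rewrite ?mul1r ?mul0r.
apply: lerD.
  rewrite -mulrA ler_wpM2l //; apply: le_trans (mult e m e0) _.
  by apply: weight => //; rewrite powRr1.
apply: le_trans (mult (e ^ 2)%N m _) _; first by rewrite expn_gt0 e0.
by apply: weight; rewrite ?expn_gt0 ?e0 // natrX powR_mulrn.
Qed.

(** * Density of the non-vanishing set *)

Lemma bad_divisor_sum_ge1 (R : realType) (nz : nat -> bool) (N P n : nat) :
  (forall p m, prime p -> ~~ (p %| N)%N -> (0 < m)%N -> ~~ (p %| m)%N ->
     nz (m * p)%N = nz p && nz m) ->
  (0 < N)%N -> (N <= P)%N -> (0 < n)%N ->
  nz n != nz (gcdn n (P`! ^ (2 * P))) ->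
  1 <= \sum_(P <= e < n.+1) bad_divisor_count R nz e n.
Proof.
move=> hm N0 NP n0 hne.
have bad0 e : 0 <= bad_divisor_count R nz e n by rewrite addr_ge0.
have [[e [Pe he]]|none] := pselect (exists e, (P <= e)%N /\
    ([&& prime e, ~~ nz e & (e %| n)%N] || (e ^ 2 %| n)%N)).
  have en : (e <= n)%N.
    case/orP: he => [/and3P[_ _ /dvdn_leq -> //]|/dvdn_leq h].
    by apply: leq_trans (h n0); case: (e) => // e'; rewrite expnS leq_pmulr ?expn_gt0.
  rewrite (bigD1_seq e) ?iota_uniq //=; last by rewrite mem_index_iota Pe.
  apply: (@le_trans _ _ (bad_divisor_count R nz e n)).
    by case/orP: he => h; rewrite /bad_divisor_count h ?lerDl ?lerDr.
  by rewrite lerDl sumr_ge0.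
move/eqP: hne; case; apply: (nonvanishing_gcd hm N0 NP n0) => e Pe.
  by apply/negP => h; apply: none; exists e; rewrite h.
by apply/negP => h; apply: none; exists e; rewrite h orbT.
Qed.

Lemma ler_norm_bool (R : realType) (b : nat -> bool) n : `|(b n)%:R| <= 1 :> R.
Proof. by rewrite ger0_norm ?ler0n // lern1; case: (b n). Qed.

(** The periodic function n |-> nz (gcd n Q) with Q = (P!)^(2P) has a density d,
and differs from nz only at multiples of bad divisors. *)
Lemma nonvanishing_density_approx (R : realType) (nz : nat -> bool) (N P : nat) (eps : R) :
  (forall p m, prime p -> ~~ (p %| N)%N -> (0 < m)%N -> ~~ (p %| m)%N ->
     nz (m * p)%N = nz p && nz m) ->
  (0 < N)%N -> (N <= P)%N ->
  (forall m, \sum_(P <= e < m)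
      ((prime e && ~~ nz e)%:R * (e%:R `^ 1)^-1 + (e%:R `^ 2)^-1) <= eps) ->
  exists Q d : R, forall z, 1 < z -> z <= 2 ->
    `|(z - 1) * dseries (fun n => (nz n)%:R) z - d| <= 2 * eps + (z - 1) * Q.
Proof.
move=> hm N0 NP heps; pose Q := (P`! ^ (2 * P))%N.
have Q0 : (0 < Q)%N by rewrite expn_gt0 fact_gt0.
have P0 : (0 < P)%N by exact: leq_trans NP.
have eps0 : 0 <= eps by have := heps 0%N; rewrite big_geq.
pose v n := nz (gcdn n Q); pose d : R := (\sum_(1 <= r < Q.+1) (v r)%:R) / Q%:R.
have QR : 0 < (Q%:R : R) by rewrite ltr0n.
exists Q%:R, d => z z1 z2.
have zm : 0 < z - 1 by rewrite subr_gt0.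
have ub := @ler_norm_bool R nz; have vb := @ler_norm_bool R v.
have one_dseries : (z - 1) * dseries (fun=> 1) z <= 2.
  have o1 (n : nat) : `|(1 : R)| <= 1 by rewrite normr1.
  rewrite mulrC -ler_pdivlMr //; apply: (@dseries_le R (fun=> 1) z 1 _ z1 o1) => m.
  by rewrite ler_pdivlMr // mulrC; apply: le_trans (dsum1_le m z1) _.
have per : `|(z - 1) * dseries (fun n => (v n)%:R) z - d| <= (z - 1) * Q%:R.
  have vQ n : (v (n + Q)%N)%:R = (v n)%:R :> R by rewrite /v gcdnC gcdnDr gcdnC.
  have := dseries_periodic z1 Q0 vb vQ.
  have -> : (z - 1) * Q%:R * dseries (fun n => (v n)%:R) z - \sum_(1 <= r < Q.+1) (v r)%:R
     = Q%:R * ((z - 1) * dseries (fun n => (v n)%:R) z - d).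
    by rewrite /d; field; rewrite gt_eqF.
  rewrite normrM (ger0_norm (ltW QR)) => h.
  rewrite -(ler_pM2l QR); apply: le_trans h _.
  by rewrite le_eqVlt; apply/orP; left; apply/eqP; ring.
have close (b c : nat -> bool) : (forall n, (0 < n)%N -> b n != c n -> nz n != v n) ->
    dseries (fun n => (b n)%:R) z - dseries (fun n => (c n)%:R) z <= eps * dseries (fun=> 1) z.
  move=> bc; have bb := @ler_norm_bool R b; have cb := @ler_norm_bool R c.
  have cb' n : `|-1 * (c n)%:R| <= 1 :> R by rewrite normrM normrN normr1 mul1r.
  have X1 n : `|(b n)%:R + -1 * (c n)%:R| <= 1 :> R.
    by case: (b n); case: (c n); rewrite ?mulr1 ?mulr0 ?subrr ?addr0 ?add0r ?normrN ?normr0 ?normr1.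
  rewrite -mulN1r -(dseriesZ _ z1 cb) -(dseriesD z1 bb cb').
  apply: (dseries_bad_divisors_le (nz := nz) z1 P0 _ _ X1 _ heps) => // [n|n n0].
    by rewrite ler01 lexx.
  have [bcn|bcn] := eqVneq (b n) (c n).
    rewrite bcn mulN1r subrr sumr_ge0 // => e _.
    by rewrite mulr1 addr_ge0.
  apply: (@le_trans _ _ 1); first by have := X1 n; rewrite ler_norml => /andP[].
  under eq_bigr => e _ do rewrite mulr1.
  exact: bad_divisor_sum_ge1 hm N0 NP n0 (bc n n0 bcn).
have c1 := close nz v (fun n _ h => h).
have c2 : dseries (fun n => (v n)%:R) z - dseries (fun n => (nz n)%:R) z
    <= eps * dseries (fun=> 1) z.
  by apply: close => n _; rewrite eq_sym.
move: per; rewrite !ler_distl => /andP[p1 p2].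
have := ler_wpM2l (ltW zm) c1; have := ler_wpM2l (ltW zm) c2.
have := ler_wpM2l eps0 one_dseries => h1 h2 h3.
apply/andP; split; lra.
Qed.

(** For n prime to P! the gcd with (P!)^(2P) is 1, where nz holds, so nz can fail
at n only through a bad divisor; such n carry at most half of the weight of
the integers prime to P!, whose density is at least 1 / P!. *)
Lemma nonvanishing_density_lower (R : realType) (nz : nat -> bool) (N P : nat) (z : R) :
  (forall p m, prime p -> ~~ (p %| N)%N -> (0 < m)%N -> ~~ (p %| m)%N ->
     nz (m * p)%N = nz p && nz m) -> nz 1%N ->
  (0 < N)%N -> (N <= P)%N ->
  (forall m, \sum_(P <= e < m)
      ((prime e && ~~ nz e)%:R * (e%:R `^ 1)^-1 + (e%:R `^ 2)^-1) <= 1 / 2 :> R) ->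
  1 < z ->
  1 / 2 * (P`!%:R^-1 - (z - 1) * P`!%:R) <= (z - 1) * dseries (fun n => (nz n)%:R) z.
Proof.
move=> hm nz1 N0 NP heps z1; set M := P`!.
have M0 : (0 < M)%N by exact: fact_gt0.
have P0 : (0 < P)%N by exact: leq_trans NP.
have MR : 0 < (M%:R : R) by rewrite ltr0n.
have zm : 0 < z - 1 by rewrite subr_gt0.
pose H (n : nat) : R := (coprime n M)%:R.
have Hb : forall n, `|H n| <= 1 := @ler_norm_bool R (fun n => coprime n M).
have H01 n : 0 <= H n <= 1 by rewrite ler0n (le_trans (ler_norm _) (Hb n)).
have Hd k d : H (k * d)%N <= H k.
  by rewrite /H coprimeMl ler_nat; case: (coprime k M); case: (coprime d M).
pose X n : R := H n + -1 * (coprime n M && nz n)%:R.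
have X1 n : `|X n| <= 1.
  rewrite /X /H; case: (coprime n M); case: (nz n) => /=;
  by rewrite ?mulr1 ?mulr0 ?subrr ?addr0 ?normr0 ?normr1.
have HX : dseries X z <= 1 / 2 * dseries H z.
  apply: (dseries_bad_divisors_le (nz := nz) z1 P0 H01 Hd X1 _ heps) => n n0.
  rewrite /X /H; case cn : (coprime n M) => /=; last first.
    by rewrite mulr0 addr0 sumr_ge0 // => e _; rewrite mulr0.
  under eq_bigr => e _ do rewrite mulr1.
  case nzn : (nz n).
    by rewrite mulr1 subrr sumr_ge0 // => e _; rewrite addr_ge0.
  rewrite mulr0 addr0; apply: bad_divisor_sum_ge1 hm N0 NP n0 _.
  rewrite -/M; have /eqP -> : coprime n (M ^ (2 * P)) by rewrite coprimeXr.
  by rewrite nz1 nzn.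
have cb := @ler_norm_bool R (fun n => coprime n M && nz n).
have cb' n : `|-1 * (coprime n M && nz n)%:R| <= 1 :> R.
  by rewrite normrM normrN normr1 mul1r.
have XE : dseries X z = dseries H z - dseries (fun n => (coprime n M && nz n)%:R) z.
  by rewrite /X (dseriesD z1 Hb cb') (dseriesZ _ z1 cb) mulN1r.
have le1 : dseries (fun n => (coprime n M && nz n)%:R) z <= dseries (fun n => (nz n)%:R) z.
  apply: (ler_dseries z1 cb (@ler_norm_bool R nz)) => n _.
  by rewrite ler_nat; case: (coprime n M).
have HM n : H (n + M)%N = H n by rewrite /H /coprime gcdnC gcdnDr gcdnC.
have := dseries_periodic z1 M0 Hb HM.
have : 1 <= \sum_(1 <= r < M.+1) H r.
  rewrite big_ltn // /H coprime1n lerDl; apply: sumr_ge0 => i _; exact: ler0n.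
set phi := \sum_(_ <= _ < _) _ => phi1; rewrite ler_distl => /andP[h _].
have h2 : M%:R^-1 - (z - 1) * M%:R <= (z - 1) * dseries H z.
  rewrite -(ler_pM2l MR) mulrBr divff ?gt_eqF //; move: h phi1; lra.
have h3 : (1 / 2) * ((z - 1) * dseries H z) <= (z - 1) * dseries (fun n => (nz n)%:R) z.
  rewrite mulrCA ler_pM2l //; move: HX; rewrite XE; lra.
by apply: le_trans h3; rewrite ler_pM2l //; lra.
Qed.

(** The approximations by periodic functions give the Cauchy criterion, and the
lower bound makes the limit positive. *)
Lemma nonvanishing_density (R : realType) (nz : nat -> bool) (N : nat) (K : R) :
  (forall p m, prime p -> ~~ (p %| N)%N -> (0 < m)%N -> ~~ (p %| m)%N ->
     nz (m * p)%N = nz p && nz m) -> nz 1%N -> (0 < N)%N ->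
  (forall m, \sum_(1 <= e < m)
      ((prime e && ~~ nz e)%:R * (e%:R `^ 1)^-1 + (e%:R `^ 2)^-1) <= K) ->
  exists delta : R, 0 < delta /\
    (z - 1) * dseries (fun n => (nz n)%:R) z @[z --> 1^'+] --> delta.
Proof.
move=> hm nz1 N0 hK.
pose w e : R := (prime e && ~~ nz e)%:R * (e%:R `^ 1)^-1 + (e%:R `^ 2)^-1.
have w0 e : 0 <= w e by rewrite addr_ge0 ?mulr_ge0 ?invpowR_ge0.
have tail e : 0 < e -> exists2 P, (N <= P)%N & forall m, \sum_(P <= i < m) w i <= e.
  move=> e0; have [P0 hP0] := summable_tail_le w0 hK e0.
  by exists (maxn P0 N) => [|m]; rewrite ?leq_maxr // hP0 // leq_maxl.
set f := fun z : R => (z - 1) * dseries (fun n => (nz n)%:R) z.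
have cf : cvg (f @ 1^'+).
  apply/cauchy_cvgP; apply: cauchy_exP => e e0.
  have e4 : 0 < e / 8 by lra.
  have [P NP hP] := tail _ e4.
  have [Q [d hd]] := nonvanishing_density_approx hm N0 NP hP.
  exists d; change (\forall z \near (1 : R)^'+, `|d - f z| < e); near=> z.
  rewrite distrC.
  have z1 : 1 < z by near: z; exact: nbhs_right_gt.
  have z2 : z <= 2 by near: z; apply: nbhs_right_le; lra.
  apply: le_lt_trans (hd z z1 z2) _.
  have Q1 : 0 < `|Q| + 1 by rewrite ltr_wpDl.
  have zQ : z <= 1 + e / (2 * (`|Q| + 1)).
    by near: z; apply: nbhs_right_le; rewrite ltrDl divr_gt0 // mulr_gt0.
  have : (z - 1) * Q <= e / 2.
    have h1 : (z - 1) * Q <= (z - 1) * (`|Q| + 1).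
      by rewrite ler_pM2l ?subr_gt0 // (le_trans (ler_norm Q)) // lerDl.
    apply: le_trans h1 _; rewrite -ler_pdivlMr //.
    have -> : e / 2 / (`|Q| + 1) = e / (2 * (`|Q| + 1)) by field; rewrite gt_eqF.
    by lra.
  by lra.
exists (lim (f @ 1^'+)); split; last exact: cf.
have h2 : (0 : R) < 1 / 2 by lra.
have [P NP hP] := tail _ h2.
have M0 : (0 : R) < P`!%:R by rewrite ltr0n fact_gt0.
apply: (@lt_le_trans _ _ (1 / 4 * P`!%:R^-1)); first by rewrite mulr_gt0 ?invr_gt0.
apply: limr_ge => //; near=> z.
have z1 : 1 < z by near: z; exact: nbhs_right_gt.
apply: le_trans (nonvanishing_density_lower hm nz1 N0 NP hP z1).
have zM : z <= 1 + 1 / 2 * P`!%:R^-1 / P`!%:R.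
  by near: z; apply: nbhs_right_le; rewrite ltrDl divr_gt0 // mulr_gt0 // invr_gt0.
have : (z - 1) * P`!%:R <= 1 / 2 * P`!%:R^-1 by rewrite -ler_pdivlMr //; lra.
lra.
Unshelve. all: by end_near. Qed.

(** * Equidistribution of signs *)

Lemma dd_density_dseries (R : realType) (A : set nat) (b : nat -> bool) (delta : R) :
  (forall n, (0 < n)%N -> (n \in A) = b n) ->
  (z - 1) * dseries (fun n => (b n)%:R) z @[z --> 1^'+] --> delta ->
  dd_density A delta.
Proof.
move=> Ab; rewrite /dd_density.
suff -> : (fun z : R => (z - 1) *
      limn (fun m : nat => \sum_(1 <= n < m | n \in A) (n%:R `^ z)^-1)) =
    (fun z => (z - 1) * dseries (fun n => (b n)%:R) z) by [].
apply/funext => z; congr (_ * _); rewrite /dseries; congr (limn _); apply/funext => m.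
rewrite big_mkcond /dsum; apply: eq_big_nat => n /andP[n0 _].
by rewrite Ab //; case: (b n); rewrite ?mul1r ?mul0r.
Qed.

Lemma sum_mkprime (R : realType) (g : nat -> R) m :
  \sum_(1 <= i < m | prime i) g i = \sum_(1 <= i < m) (if prime i then g i else 0).
Proof. by rewrite big_mkcond. Qed.

(** Leaving out the at most N primes dividing N costs at most 1 each; the squares
contribute at most 2 zeta(2) <= 4. *)
Lemma euler_exponent_le (R : realType) (s : nat -> R) (z K1 : R) N P :
  1 < z -> (0 < N)%N -> (forall n, `|s n| <= 1) ->
  (forall m, dsum (fun i => if prime i then s i else 0) z m <= K1) ->
  \sum_(0 <= p < P | prime p && ~~ (p %| N)%N)
     (s p * (p%:R `^ z)^-1 + 2 * (p%:R `^ 2)^-1) <= K1 + N%:R + 4.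
Proof.
move=> z1 N0 sb hK.
case: P => [|P].
  rewrite big_geq //; have := hK 0%N; rewrite /dsum big_geq // => h.
  by rewrite addr_ge0 // addr_ge0.
rewrite big_ltn_cond //= big_mkcond.
have dn : \sum_(1 <= p < P.+1) (p <= N)%N%:R <= N%:R :> R by exact: sum_leq_le.
have z2 : (1 : R) < 2 by lra.
have := @dsum1_le R 2 P.+1 z2 => d2.
apply: (@le_trans _ _ (dsum (fun i => if prime i then s i else 0) z P.+1
   + \sum_(1 <= p < P.+1) (p <= N)%N%:R + 2 * dsum (fun=> 1) 2 P.+1)); last first.
  by apply: lerD; [apply: lerD|lra].
rewrite /dsum mulr_sumr -!big_split /=; apply: ler_sum_nat => p /andP[p0 _].
have w0 := @invpowR_ge0 R p%:R 2; have w1 := @invpowR_ge0 R p%:R z.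
case pp : (prime p) => /=; last by rewrite mul0r add0r mul1r addr_ge0 // mulr_ge0.
have [pN|pN] /= := boolP (p %| N)%N; last by rewrite mul1r -addrA lerD2l lerDr.
rewrite (dvdn_leq N0 pN) mul1r /=.
have : -1 <= s p * (p%:R `^ z)^-1.
  have : `|s p * (p%:R `^ z)^-1| <= 1.
    rewrite normrM (ger0_norm w1) mulr_ile1 //.
    by rewrite invf_le1 ?powR_gt0 ?ltr0n // powR_ge1 ?ler1n // ltW // (lt_trans ltr01).
  by rewrite ler_norml => /andP[].

lra.
Qed.

(** The indicator functions of the positive and negative values are
(|s| + s) / 2 and (|s| - s) / 2 for the sign s, and the series of s is bounded
near z = 1. *)
Lemma sign_density (R : realType) (c : nat -> R) (N : nat) (C beta : R) :
  (0 < N)%N -> (2 %| N)%N -> 0 < beta -> beta < 1 -> 0 <= C -> 0 < c 1%N ->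
  (forall p j m, prime p -> ~~ (p %| N)%N -> (0 < m)%N -> ~~ (p %| m)%N ->
     Num.sg (c (m * p ^ j)%N) = Num.sg (c (p ^ j)%N) * Num.sg (c m)) ->
  (forall m, (0 < m)%N ->
    \sum_(1 <= i < m.+1 | prime i) Num.sg (c i) <= C * m%:R `^ (1 - beta) /\
    \sum_(1 <= i < m.+1 | prime i) (c i == 0)%R%:R <= C * m%:R `^ (1 - beta)) ->
  exists delta : R,
    [/\ 0 < delta,
        dd_density [set n | (0 < n)%N /\ c n != 0] delta,
        dd_density [set n | (0 < n)%N /\ 0 < c n] (delta / 2)
      & dd_density [set n | (0 < n)%N /\ c n < 0] (delta / 2)].
Proof.
move=> N0 N2 b0 b1 C0 c1 hm hsum.
pose s n := Num.sg (c n); pose nz n := c n != 0.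
have sb n : `|s n| <= 1 by rewrite /s normr_sg lern1; case: (_ == _).
have s1 : s 1%N = 1 by rewrite /s gtr0_sg.
have hs p : prime p -> ~~ (p %| N)%N -> factors_at s p s.
  by move=> pp pN j m m0 pm; exact: hm.
have hnz p m : prime p -> ~~ (p %| N)%N -> (0 < m)%N -> ~~ (p %| m)%N ->
    nz (m * p)%N = nz p && nz m.
  move=> pp pN m0 pm; have := hm p 1%N m pp pN m0 pm; rewrite expn1 => h.
  by rewrite /nz -!(sgr_eq0 (c _)) h mulf_eq0 negb_or.
set K1 := C + 2 * C * ((1 + beta) / beta).
have Ks z m : 1 <= z -> z <= 2 -> dsum (fun i => if prime i then s i else 0) z m <= K1.
  move=> z1 z2; apply: (abel_summation_le m b0 b1 C0 z1 z2) => n n0.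
  by rewrite -sum_mkprime; have [] := hsum n n0.
have Kz m : \sum_(1 <= e < m) ((prime e && ~~ nz e)%:R * (e%:R `^ 1)^-1 + (e%:R `^ 2)^-1)
    <= K1 + 2 :> R.
  have l12 : (1 : R) <= 2 by lra.
  rewrite big_split /=; apply: lerD.
    have := abel_summation_le (b := fun i => if prime i then (c i == 0)%:R else 0)
       m b0 b1 C0 (lexx 1) l12 => h.
    apply: le_trans (h _); last by move=> n n0; rewrite -sum_mkprime; have [] := hsum n n0.
    by apply: ler_sum => i _; rewrite /nz negbK; case: (prime i).
  have := @dsum1_le R 2 m; rewrite /dsum => h.
  under eq_bigr => i _ do rewrite -[_^-1]mul1r.
  by have := h (_ : 1 < 2); lra.
have nz1 : nz 1%N by rewrite /nz gt_eqF.
have [delta [d0 hd]] := nonvanishing_density hnz nz1 N0 Kz.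
have sgn0 : (z - 1) * dseries s z @[z --> 1^'+] --> (0 : R).
  set B := 2 ^+ size (primes N) * expR (K1 + N%:R + 4).
  have B0 : 0 < B + 1.
    by rewrite ltr_wpDl // mulr_ge0 ?expR_ge0 ?exprn_ge0.
  apply/cvgrPdist_le => e e0; near=> z.
  have z1 : 1 < z by near: z; exact: nbhs_right_gt.
  have z2 : z <= 2 by near: z; apply: nbhs_right_le; lra.
  have zB : z <= 1 + e / (B + 1) by near: z; apply: nbhs_right_le; rewrite ltrDl divr_gt0.
  have : `|dseries s z| <= B.
    apply: (dseries_factoring_bounded z1 N2 s1 sb _ _ sb hs).
    - by move=> P; apply: euler_exponent_le => // m; apply: Ks; rewrite // ltW.
    - by move=> q; rewrite mem_primes => /and3P[-> _ ->].
    - by move=> n q n0 _ qp qN _; rewrite mem_primes qp N0.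
  move=> h; rewrite sub0r normrN normrM gtr0_norm ?subr_gt0 //.
  apply: (@le_trans _ _ ((z - 1) * (B + 1))).
    by rewrite ler_pM2l ?subr_gt0 // (le_trans h) // lerDl.
  by rewrite -ler_pdivlMr //; lra.
have half (b : nat -> bool) (eps : R) :
    (forall n, (b n)%:R = 2^-1 * (nz n)%:R + (eps / 2) * s n) ->
    (z - 1) * dseries (fun n => (b n)%:R) z @[z --> 1^'+] --> delta / 2.
  move=> bE.
  have lim : 2^-1 * ((z - 1) * dseries (fun n => (nz n)%:R) z)
     + (eps / 2) * ((z - 1) * dseries s z) @[z --> 1^'+] --> delta / 2.
    rewrite -[X in _ --> X]addr0 -(mulr0 (eps / 2)) [delta / 2]mulrC.
    by apply: cvgD; apply: cvgMl_tmp.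
  apply: cvg_trans lim; apply: near_eq_cvg; near=> z.
  have z1 : 1 < z by near: z; exact: nbhs_right_gt.
  have nzb := @ler_norm_bool R nz.
  have hb1 n : `|2^-1 * (nz n)%:R| <= `|2^-1| :> R.
    by rewrite normrM ler_piMr.
  have hb2 n : `|eps / 2 * s n| <= `|eps / 2|.
    by rewrite normrM ler_piMr.
  rewrite (@eq_dseries _ (fun n => (b n)%:R) (fun n => 2^-1 * (nz n)%:R + eps / 2 * s n)) //.
  rewrite (dseriesD z1 hb1 hb2) (dseriesZ _ z1 nzb) (dseriesZ _ z1 sb); ring.
exists delta; split=> //.
- apply: dd_density_dseries hd => n n0; rewrite /nz.
  by apply/idP/idP; rewrite inE /=; [case|split].
- apply: (dd_density_dseries (b := fun n => 0 < c n)); last first.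
    apply: (half _ 1) => n; rewrite /nz /s.
    by case: (sgrP (c n)) => /=; rewrite ?mulr1 ?mulr0 ?addr0 ?mulrN1; lra.
  by move=> n n0; apply/idP/idP; rewrite inE /=; [case|split].
- apply: (dd_density_dseries (b := fun n => c n < 0)); last first.
    apply: (half _ (-1)) => n; rewrite /nz /s.
    by case: (sgrP (c n)) => /=; rewrite ?mulr1 ?mulr0 ?addr0 ?mulrN1; lra.
  by move=> n n0; apply/idP/idP; rewrite inE /=; [case|split].
Unshelve. all: by end_near. Qed.

Theorem corollary5p2 (R : realType) (k N : nat) (hk : (2 <= k)%N)
  (hN : (0 < N)%N) (h4N : (4 %| N)%N)
  (chi : int -> R[i]) (hchi : dirichlet_character N chi)
  (hchi2 : principal N (fun m : int => chi m ^+ 2))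
  (f : R[i] -> R[i]) (a : nat -> R)
  (hf : half_integral_cusp_form k N chi f)
  (hfa : q_expansion f (fun n : nat => (a n)%:C))
  (hf0 : exists z : R[i], 0 < complex.Im z /\ f z <> 0)
  (heig : hecke_eigenform k N chi (fun n : nat => (a n)%:C))
  (t : nat) (ht : squarefree t) (hat : 0 < a t)
  (hCM : ~ has_CM (shimura_coef k N t chi (fun n : nat => (a n)%:C)))
  (hST : exists C alpha : R, [/\ 0 < C, 0 < alpha &
     forall u v x : R, -1 <= u -> u <= v -> v <= 1 -> 2 <= x ->
       `| (prime_count
             (fun p : nat =>
                u%:C <= shimura_coef k N t chi (fun n : nat => (a n)%:C) p
                        / (2 * a t * p%:R `^ (k%:R - 2^-1))%:C
                     <= v%:C) x)%:R
          / (prime_count predT x)%:R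
          - sato_tate `[u, v] |
       <= C / x `^ alpha]) :
  exists delta : R,
    [/\ 0 < delta,
        dd_density [set n : nat | (0 < n)%N /\ a (t * n ^ 2)%N != 0] delta,
        dd_density [set n : nat | (0 < n)%N /\ 0 < a (t * n ^ 2)%N] (delta / 2)
      & dd_density [set n : nat | (0 < n)%N /\ a (t * n ^ 2)%N < 0] (delta / 2)].
Proof.
have [C [alpha [C0 alpha0 hrate]]] := hST.
have t0 : (0 < t)%N.
  rewrite lt0n; apply/negP => /eqP t0; have := ht 2%N; rewrite t0 dvdn0; by move=> /(_ isT).
have N2 : (2 %| N)%N by apply: dvdn_trans h4N.
pose A p := shimura_coef k N t chi (fun n => (a n)%:C) p
                        / (2 * a t * p%:R `^ (k%:R - 2^-1))%:C.
pose B p := complex.Re (A p).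
pose y p := a (t * p ^ 2)%N / (2 * a t * p%:R `^ (k%:R - 2^-1)).
have AB p : prime p -> A p = (B p)%:C /\ `|B p - y p| <= (2 * Num.sqrt p%:R)^-1.
  move=> pp; have [e [e1 AE]] := shimura_coef_prime hk hchi hchi2 hat pp.
  rewrite /B /A AE /=; split=> //.
  have w0 : 0 <= (2 * Num.sqrt (p%:R : R))^-1 by rewrite invr_ge0 mulr_ge0 ?sqrtr_ge0.
  by rewrite addrAC subrr add0r normrM (ger0_norm w0) ler_piMl.
have ysg p : prime p -> Num.sg (y p) = Num.sg (a (t * p ^ 2)%N).
  move=> pp; rewrite /y sgrM [X in _ * X]gtr0_sg ?mulr1 //.
  by rewrite invr_gt0 !mulr_gt0 // powR_gt0 // ltr0n prime_gt0.
pose beta := Num.min alpha (1 / 4).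
have b0 : 0 < beta by rewrite lt_min alpha0; lra.
have ba : beta <= alpha by rewrite ge_min lexx.
have b4 : beta <= 1 / 4 by rewrite ge_min lexx orbT.
have counts := @prime_sign_sums_le R y B C alpha beta C0 alpha0 ba b4
  (fun p pp => (AB p pp).2).
apply: (@sign_density R (fun n => a (t * n ^ 2)%N) N (4 + 2 * C) beta) => //.
- lra.
- lra.
- by rewrite exp1n muln1.
- move=> p j m pp pN m0 pm.
  have p2 : p != 2%N by apply: contra pN => /eqP ->.
  have := eigenform_square_multiplicative j heig ht t0 pp p2 pN m0 pm.
  move=> /(congr1 Num.sg); rewrite !sgrM (gtr0_sg hat) mulr1 => <-.
  by rewrite [(m * _)%N]mulnC.
- move=> m m0.
  have -> : \sum_(1 <= i < m.+1 | prime i) Num.sg (a (t * i ^ 2)%N) =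
            \sum_(1 <= i < m.+1 | prime i) Num.sg (y i).
    by apply: eq_bigr => i pi; rewrite ysg.
  have -> : \sum_(1 <= i < m.+1 | prime i) (a (t * i ^ 2)%N == 0)%R%:R =
            \sum_(1 <= i < m.+1 | prime i) (y i == 0)%R%:R :> R.
    by apply: eq_bigr => i pi; rewrite -(sgr_eq0 (y i)) ysg // sgr_eq0.
  apply: counts => // u v {m0}n u1 uv v1 n2.
  have := hrate u v n%:R u1 uv v1; rewrite ler_nat => /(_ n2).
  rewrite !prime_countE.
  have -> : \sum_(1 <= i < n.+1 | prime i) (u%:C <= A i <= v%:C)%R%:R =
            \sum_(1 <= i < n.+1 | prime i) (u <= B i <= v)%R%:R :> R.
    by apply: eq_bigr => i pi; have [-> _] := AB i pi; rewrite !lecR.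
  by [].
Qed.
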